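(* Let $\alpha\in\mathbb{R}$, let $(M,\mathcal{T},I)$ be a weighted closed triangulated surface with $I\ge 0$ and $\alpha\chi(M)\le 0$, and let $\overline{R}\in C(V)$ be a given function on $V$. (1) (Euclidean background geometry) If $\alpha\overline{R}\equiv 0$, then there exists at most one Euclidean inversive distance circle packing metric $\overline{r}\in\Omega$, up to scaling $r\mapsto cr$ ($c>0$), with $\alpha$-curvature $\overline{R}$. If $\alpha\overline{R}\le 0$ and $\alpha\overline{R}\not\equiv 0$, then there exists at most one Euclidean inversive distance circle packing metric $\overline{r}\in\Omega$ with $\alpha$-curvature $\overline{R}$. (2) (Hyperbolic background geometry) If $\alpha\overline{R}\le 0$, then there exists at most one hyperbolic inversive distance circle packing metric $\overline{r}\in\Omega$ with $\alpha$-curvature $\overline{R}$.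
   Context: $M$ is a closed surface with a triangulation $\mathcal{T}=\{V,E,F\}$ (vertices, edges, faces), $V=\{1,\dots,N\}$; $C(V)$ is the set of functions $V\to\mathbb{R}$, and inequalities between functions are pointwise. A weight is a function $I:E\to[0,+\infty)$ (written $I\ge0$), called the inversive distance; $(M,\mathcal{T},I)$ is a weighted triangulated surface. $\chi(M)$ is the Euler number. For $r\in\mathbb{R}^N_{>0}$, the length of an edge $\{ij\}\in E$ is $l_{ij}=\sqrt{r_i^2+r_j^2+2r_ir_jI_{ij}}$ in Euclidean background geometry, and $l_{ij}=\cosh^{-1}(\cosh r_i\cosh r_j+I_{ij}\sinh r_i\sinh r_j)$ in hyperbolic background geometry. The admissible space is $\Omega=\{r\in\mathbb{R}^N_{>0}: l_{ij}<l_{ik}+l_{kj},\ l_{ik}<l_{ij}+l_{jk},\ l_{jk}<l_{ji}+l_{ik}\ \text{for all faces } \triangle ijk\in F\}$ (it depends on the background geometry). An element $r\in\Omega$ is called a (Euclidean, resp. hyperbolic) inversive distance circle packing metric. For $r\in\Omega$, each face $\triangle ijk$ is realized as a Euclidean (resp. hyperbolic) triangle with edge lengths $l_{ij},l_{jk},l_{ik}$, and $\theta_i^{jk}$ is its inner angle at $i$. The classical combinatorial Gauss curvature is $K_i=2\pi-\sum_{\triangle ijk\in F}\theta_i^{jk}$ (sum over faces having $i$ as a vertex). The $\alpha$-curvature is $R_{\alpha,i}=K_i/r_i^\alpha$ in Euclidean background geometry and $R_{\alpha,i}=K_i/\tanh^\alpha\frac{r_i}{2}$ in hyperbolic background geometry.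 *)

(* Defs.v *)
From HB Require Import structures.
From mathcomp Require Import all_boot all_order all_algebra.
From mathcomp Require Import reals sequences exp trigo.
From mathcomp Require Import ring lra.

Set Implicit Arguments.
Unset Strict Implicit.
Unset Printing Implicit Defensive.

Import Order.TTheory GRing.Theory Num.Theory.
Local Open Scope ring_scope.

(** A triangulation of a (nonempty, connected) closed surface, as a finite pure
    two-dimensional simplicial complex on the vertices ['I_N].  As every edge
    lies in exactly two faces, the link of a vertex is a disjoint union of
    cycles, and [link_connected] says that it is a single cycle, i.e. that the
    vertex has a disk neighbourhood.  Orientability is not required. *)
Record triangulated_surface (N : nat) := TriangulatedSurface {
  edges : {set {set 'I_N}};
  faces : {set {set 'I_N}};
  vertices_nonempty : (0 < N)%N;
  vertex_in_face : forall v : 'I_N, exists2 f, f \in faces & v \in f;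
  face_card : forall f, f \in faces -> #|f| = 3%N;
  edgeP : forall e : {set 'I_N}, e \in edges <->
    #|e| = 2%N /\ exists2 f, f \in faces & e \subset f;
  two_faces_per_edge : forall e, e \in edges ->
    #|[set f in faces | e \subset f]| = 2%N;
  link_connected : forall v a b : 'I_N,
    [set v; a] \in edges -> [set v; b] \in edges ->
    connect (fun x y => [set v; x; y] \in faces) a b;
  surface_connected : forall u v : 'I_N,
    connect (fun x y => [set x; y] \in edges) u v
}.

Definition euler_number (N : nat) (T : triangulated_surface N) : int :=
  N%:Z - #|edges T|%:Z + #|faces T|%:Z.

Section hyperbolic_functions.
Context {R : realType}.
Implicit Types x : R.

Definition cosh x : R := (expR x + expR (- x)) / 2.
Definition sinh x : R := (expR x - expR (- x)) / 2.
Definition tanh x : R := sinh x / cosh x.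
Definition arcosh x : R := ln (x + Num.sqrt (x ^+ 2 - 1)).

Lemma cosh2_sinh2 x : cosh x ^+ 2 - sinh x ^+ 2 = 1.
Proof.
by rewrite /cosh /sinh -[RHS](expRxMexpNx_1 x); field.
Qed.

Lemma arcosh_ge0 x : 1 <= x -> 0 <= arcosh x.
Proof.
by move=> x1; rewrite ln_ge0// -[leLHS]addr0 lerD// sqrtr_ge0.
Qed.

Lemma arcoshK x : 1 <= x -> cosh (arcosh x) = x.
Proof.
move=> x1; set s := Num.sqrt (x ^+ 2 - 1).
have s0 : 0 <= s by exact: sqrtr_ge0.
have s2 : s ^+ 2 = x ^+ 2 - 1 by rewrite sqr_sqrtr//; nra.
have xs : 0 < x + s by lra.
rewrite /cosh expRN /arcosh -/s lnK ?posrE//.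
have -> : (x + s)^-1 = x - s.
  by apply: (mulfI (lt0r_neq0 xs)); rewrite divff ?lt0r_neq0//; nra.
by field.
Qed.

Lemma sinh_ge0 x : 0 <= x -> 0 <= sinh x.
Proof.
by move=> x0; rewrite /sinh divr_ge0// subr_ge0 ler_expR; lra.
Qed.

Lemma sinh_arcosh x : 1 <= x -> sinh (arcosh x) = Num.sqrt (x ^+ 2 - 1).
Proof.
move=> x1; rewrite -{2}(arcoshK x1) -[X in _ - X](cosh2_sinh2 (arcosh x)).
by rewrite opprB addrC subrK sqrtr_sqr ger0_norm// sinh_ge0// arcosh_ge0.
Qed.

End hyperbolic_functions.

Inductive geometry := Euclidean | Hyperbolic.

(** The angle opposite to the side of length [a] in a triangle with side
    lengths [a], [b], [c], by the law of cosines; [euclidean_inner_angle] and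
    [hyperbolic_inner_angle] below compare it with actual triangles. *)
Definition inner_angle (R : realType) (g : geometry) (a b c : R) : R :=
  match g with
  | Euclidean => acos ((b ^+ 2 + c ^+ 2 - a ^+ 2) / (2 * b * c))
  | Hyperbolic =>
      acos ((cosh b * cosh c - cosh a) / (sinh b * sinh c))
  end.

Section euclidean_triangles.
Context {R : realType}.
Implicit Types u v A B C : 'rV[R]_2.

Definition dot u v : R := u 0 0 * v 0 0 + u 0 1 * v 0 1.
Definition enorm u : R := Num.sqrt (dot u u).

Lemma euclidean_inner_angle A B C :
  inner_angle Euclidean (enorm (C - B)) (enorm (C - A)) (enorm (B - A)) =
  acos (dot (C - A) (B - A) / (enorm (C - A) * enorm (B - A))).
Proof.
have sq u : enorm u ^+ 2 = dot u u.
  by rewrite sqr_sqrtr// /dot addr_ge0// -expr2 sqr_ge0.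
rewrite /= !sq -mulrA; congr acos.
have -> : dot (C - A) (C - A) + dot (B - A) (B - A) - dot (C - B) (C - B) =
    2 * dot (C - A) (B - A) by rewrite /dot !mxE; ring.
by rewrite -mulf_div divff ?pnatr_eq0 ?mul1r.
Qed.

End euclidean_triangles.

(** The hyperbolic plane as the hyperboloid in Minkowski space: [- mink]
    restricts to the Riemannian metric, and [B - mink A B *: A] is a tangent
    vector at [A] of the geodesic from [A] to [B]. *)
Section hyperbolic_triangles.
Context {R : realType}.
Implicit Types u v A B C : 'rV[R]_3.

Definition mink u v : R :=
  u 0 0 * v 0 0 - u 0 1 * v 0 1 - u 0 2%:R * v 0 2%:R.
Definition hyperboloid u := mink u u = 1 /\ 0 < u 0 0.
Definition hdist A B : R := arcosh (mink A B).
Definition hnorm u : R := Num.sqrt (- mink u u).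
Definition htangent A B := B - mink A B *: A.

Lemma mink_ge1 A B : hyperboloid A -> hyperboloid B -> 1 <= mink A B.
Proof.
rewrite /hyperboloid /mink; move: (A 0 0) (A 0 1) (A 0 2%:R) => a b c.
move: (B 0 0) (B 0 1) (B 0 2%:R) => x y z [hA a0] [hB x0].
have ax : 0 < a * x by exact: mulr_gt0.
suff : 1 + b * y + c * z <= a * x by lra.
rewrite (le_trans (ler_norm _))// -ler_sqr ?nnegrE ?(ltW ax)//.
rewrite real_normK ?num_real//.
have -> : (a * x) ^+ 2 = (1 + b ^+ 2 + c ^+ 2) * (1 + y ^+ 2 + z ^+ 2).
  by rewrite exprMn; congr (_ * _); lra.
rewrite -subr_ge0; have -> : (1 + b ^+ 2 + c ^+ 2) * (1 + y ^+ 2 + z ^+ 2) -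
    (1 + b * y + c * z) ^+ 2 =
  (b - y) ^+ 2 + (c - z) ^+ 2 + (b * z - c * y) ^+ 2 by ring.
by rewrite !addr_ge0// sqr_ge0.
Qed.

Lemma hyperbolic_inner_angle A B C :
  hyperboloid A -> hyperboloid B -> hyperboloid C ->
  inner_angle Hyperbolic (hdist B C) (hdist A C) (hdist A B) =
  acos (- mink (htangent A C) (htangent A B) /
        (hnorm (htangent A C) * hnorm (htangent A B))).
Proof.
move=> hA hB hC; have tE X Y : mink (htangent A X) (htangent A Y) =
    mink X Y - mink A X * mink A Y.
  have -> : mink (htangent A X) (htangent A Y) =
      mink X Y - 2 * mink A X * mink A Y + mink A X * mink A Y * mink A A.
    by rewrite /htangent /mink !mxE; ring.
  by rewrite (proj1 hA); ring.
have mC X Y : mink X Y = mink Y X by rewrite /mink; ring.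
have nE X : hyperboloid X -> hnorm (htangent A X) = sinh (hdist A X).
  move=> hX; rewrite sinh_arcosh ?mink_ge1// /hnorm tE (proj1 hX).
  by rewrite opprB expr2.
rewrite /= !nE// tE opprB /hdist !arcoshK ?mink_ge1//.
by rewrite (mC C B).
Qed.

End hyperbolic_triangles.

Section inversive_distance_circle_packings.
Context {R : realType} {N : nat}.
Variables (g : geometry) (T : triangulated_surface N).
Implicit Types (I : {set 'I_N} -> R) (r : 'I_N -> R).

(** Only the values of a weight on [edges T] are meaningful. *)
Definition nonneg_weight I := forall e, e \in edges T -> 0 <= I e.

Definition edge_length I r (i j : 'I_N) : R :=
  match g with
  | Euclidean =>
      Num.sqrt (r i ^+ 2 + r j ^+ 2 + 2 * r i * r j * I [set i; j])
  | Hyperbolic =>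
      arcosh (cosh (r i) * cosh (r j) + I [set i; j] * sinh (r i) * sinh (r j))
  end.

(** Membership in the admissible space; the three inequalities of a face come
    from the orderings of its vertices. *)
Definition packing_metric I r :=
  (forall i, 0 < r i) /\
  (forall i j k, [set i; j; k] \in faces T ->
     edge_length I r i j < edge_length I r i k + edge_length I r k j).

Definition face_angle I r (i j k : 'I_N) : R :=
  inner_angle g (edge_length I r j k)
    (edge_length I r i j) (edge_length I r i k).

(** Faces have three distinct vertices, so that each face at [i] is counted
    exactly once, through its other two vertices [j < k]. *)
Definition gauss_curvature I r (i : 'I_N) : R :=
  2 * pi - \sum_(j < N) \sum_(k < N | (j < k)%N && ([set i; j; k] \in faces T))
    face_angle I r i j k.

Definition alpha_curvature (alpha : R) I r (i : 'I_N) : R :=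
  match g with
  | Euclidean => gauss_curvature I r i / r i `^ alpha
  | Hyperbolic => gauss_curvature I r i / tanh (r i / 2) `^ alpha
  end.

End inversive_distance_circle_packings.

(* Main.v *)
Require Import Defs.
From mathcomp Require Import all_boot all_order all_algebra.
From mathcomp Require Import boolp classical_sets reals topology normedtype.
From mathcomp Require Import derive sequences realfun exp trigo.
From mathcomp Require Import ring lra.

Set Implicit Arguments.
Unset Strict Implicit.
Unset Printing Implicit Defensive.

Import Order.TTheory GRing.Theory Num.Theory.
Import numFieldNormedType.Exports.
Local Open Scope ring_scope.

(* In the coordinates u_i = ln r_i (Euclidean) or u_i = ln tanh (r_i / 2)
   (hyperbolic), the angles of one triangle are strictly monotone: for two
   admissible u <> u' (not differing by a constant, in the Euclidean case)
   sum_i (u'_i - u_i) (theta_i (u') - theta_i (u)) < 0.  The admissible set need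
   not contain the segment from u to u', so the angles are extended as by Luo to
   degenerate triangles, with values 0 and pi.  Along the segment, the function
   f (t) = sum_i (u'_i - u_i) theta_i (u + t (u' - u)) is then continuous, has
   negative derivative wherever the triangle is nondegenerate, and takes only
   finitely many values elsewhere; such a function satisfies f (1) < f (0).
   The sign of the derivative is the definiteness of the Jacobian of the angles,
   which is written with edge weights proportional to the distances from the
   radical center to the sides: for I >= 0 at most one of them is negative.

   Summing over the faces gives sum_i (u'_i - u_i) (K'_i - K_i) >= 0, whereas
   K_i = Rbar_i r_i^alpha (resp. Rbar_i tanh^alpha (r_i / 2)) and
   alpha Rbar_i <= 0 make every term nonpositive. *)

(** * Angles of possibly degenerate triangles *)

Section clipped_acos.
Context {R : realType}.
Implicit Types (x y p q t : R) (f g : R -> R).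

Definition clip x : R := Num.max (-1) (Num.min 1 x).

Lemma clip_itv x : -1 <= clip x <= 1.
Proof. by rewrite le_max lexx/= ge_max ge_min lexx/= andbT; lra. Qed.

Lemma clip_id x : -1 <= x <= 1 -> clip x = x.
Proof. by move=> /andP[? ?]; rewrite /clip min_r// max_r. Qed.

Lemma clip_sqr_ge1 x : 1 <= x ^+ 2 -> clip x = 1 \/ clip x = -1.
Proof.
move=> h; have [x1|x1] := leP 1 x; first by left; rewrite /clip min_l// max_r//; lra.
by right; rewrite /clip min_r ?ltW// max_l//; nra.
Qed.

(** At the endpoints [1] and [-1] only continuity within the segment is available, from [acos] being
    the inverse of [cos] on [[0, pi]]; this suffices because [clip] never leaves the segment. *)
Lemma acos_clip_continuous : continuous (fun x => acos (clip x)).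
Proof.
move=> x.
have cc : ({within `[(-1)%R, 1%R], continuous (@acos R)})%classic.
  have := @segment_can_ge_continuous R 0 pi cos (@acos R) (pi_ge0 R).
  rewrite cos0 cospi; apply; last exact: cosK.
  exact/continuous_subspaceT/continuous_cos.
have cx : `[(-1)%R, 1%R]%classic (clip x) by rewrite /= in_itv/= clip_itv.
move/subspace_continuousP : cc => cc B /(cc _ cx); rewrite /within/= nbhs_simpl/= => hA.
have cl : {for x, continuous clip}.
  apply: continuous_max; first exact: cvg_cst.
  by apply: continuous_min; [exact: cvg_cst|exact: cvg_id].
have := cl _ hA; rewrite !nbhs_simpl /=; apply: filterS => z; apply.
by rewrite /= in_itv/= clip_itv.
Qed.

(* The angle with cosine [p / sqrt q], extended by [0] or [pi] to degenerate
   triangles, where [p ^+ 2 >= q]. *)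
Definition angle p q : R := acos (clip (p / Num.sqrt q)).

Lemma angleE p q : p ^+ 2 < q -> angle p q = acos (p / Num.sqrt q).
Proof.
move=> pq; have q0 : 0 < q by rewrite (le_lt_trans (sqr_ge0 p)).
rewrite /angle clip_id// -ler_norml normrM normfV (ger0_norm (sqrtr_ge0 _)).
rewrite ler_pdivrMr ?sqrtr_gt0// mul1r -sqrtr_sqr (ler_sqrt _ (ltW q0))//; exact: ltW.
Qed.

Lemma angle_degenerate p q : 0 < q -> q <= p ^+ 2 -> angle p q \in [:: 0; pi].
Proof.
move=> q0 qp; rewrite /angle.
have [|->|->] := @clip_sqr_ge1 (p / Num.sqrt q).
- by rewrite expr_div_n (sqr_sqrtr (ltW q0)) ler_pdivlMr// mul1r.
- by rewrite acos1 inE eqxx.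
- by rewrite acosN1 !inE eqxx orbT.
Qed.

Lemma angle_continuous f g t : {for t, continuous f} -> {for t, continuous g} ->
  0 < g t -> {for t, continuous (fun z => angle (f z) (g z))}.
Proof.
move=> cf cg g0.
apply: (@continuous_comp _ _ _ (fun z => f z / Num.sqrt (g z)) (fun x => acos (clip x)));
  last exact: acos_clip_continuous.
apply: cvgM => //; apply: cvgV; first by rewrite gt_eqF// sqrtr_gt0.
by apply: (@continuous_comp _ _ _ g Num.sqrt) => //; exact: sqrt_continuous.
Qed.

Lemma is_derive_continuous f t df : is_derive t 1 f df -> {for t, continuous f}.
Proof. by move=> [/derivable1_diffP/differentiable_continuous]. Qed.

(** In this form the denominator is [sqrt (q - p ^+ 2)], which takes the same value at the three
    corners of a triangle, so that the sign of a sum of derivatives is read off the numerators. *)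
Lemma is_derive_angle f g t df dg :
  is_derive t 1 f df -> is_derive t 1 g dg -> f t ^+ 2 < g t ->
  is_derive t 1 (fun z => angle (f z) (g z))
    (- (df - f t * dg / (2 * g t)) / Num.sqrt (g t - f t ^+ 2)).
Proof.
move=> hf hg fg; have g0 : 0 < g t by rewrite (le_lt_trans (sqr_ge0 (f t))).
have cf := is_derive_continuous hf; have cg := is_derive_continuous hg.
(* The condition [f ^+ 2 < g] is open, so the clipping is inactive near [t]. *)
have near_E : (\forall z \near t, acos (f z / Num.sqrt (g z)) = angle (f z) (g z))%classic.
  have c : {for t, continuous (fun z => g z - f z ^+ 2)}.
    by apply: cvgB => //; apply: cvgM.
  have := @cvgr_gt _ _ _ _ _ _ c 0; rewrite subr_gt0 => /(_ _ fg).
  by apply: filterS => z; rewrite subr_gt0 => /angleE.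
apply: (near_eq_is_derive near_E).
set s := Num.sqrt (g t); have s0 : 0 < s by rewrite sqrtr_gt0.
have s2 : s ^+ 2 = g t by rewrite (sqr_sqrtr (ltW g0)).
have D0 : 0 < g t - f t ^+ 2 by rewrite subr_gt0.
have hs := is_derive1_comp (is_derive1_sqrt g0) hg.
have hV : is_derive t 1 (fun z => (Num.sqrt (g z))^-1) (- s ^- 2 *: ((2 * s)^-1 * dg)).
  by apply: is_deriveV hs; rewrite gt_eqF.
have hq := is_deriveM hf hV.
have b : -1 < f t / s < 1.
  rewrite -ltr_norml normrM normfV (gtr0_norm s0) ltr_pdivrMr// mul1r.
  by rewrite -sqrtr_sqr ltr_sqrt.
have := @is_derive1_comp _ (@acos R) (f \* (fun z => (Num.sqrt (g z))^-1)) t _ _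
  (is_derive1_acos b) hq.
have -> : 1 - (f t / s) ^+ 2 = (g t - f t ^+ 2) / g t.
  by rewrite expr_div_n s2 mulrBl divff// gt_eqF.
rewrite (sqrtrM _ (ltW D0)) (sqrtrV (ltW g0)) -/s => H; apply: is_derive_eq H _.
have : Num.sqrt (g t - f t ^+ 2) != 0 by rewrite gt_eqF// sqrtr_gt0.
move: (Num.sqrt _) => d d0; rewrite -s2 /GRing.scale /=; field.
by rewrite d0 gt_eqF.
Qed.

End clipped_acos.

(** * Functions with negative derivative away from finitely many values *)

Section decrease_off_finite.
Context {R : realType}.
Implicit Types (f : R -> R) (t a b : R).

Lemma open_interval_notin (s : seq R) a b : a < b ->
  exists2 y, a < y < b & y \notin s.
Proof.
elim: s a b => [|x s IH] a b ab; first by exists ((a + b) / 2) => //; lra.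
(* The half of the interval that avoids [x] is kept. *)
have [xm|mx] := leP x ((a + b) / 2).
  have [|y /andP[my yb] ys] := IH ((a + b) / 2) b; first by lra.
  by exists y; [lra|rewrite inE negb_or ys andbT gt_eqF//; lra].
have [|y /andP[my yb] ys] := IH a ((a + b) / 2); first by lra.
by exists y; [lra|rewrite inE negb_or ys andbT lt_eqF//; lra].
Qed.

Lemma derive_lt0_right f t df e : is_derive t 1 f df -> df < 0 -> 0 < e ->
  exists2 z, t < z < t + e & f z < f t.
Proof.
move=> [cf fE] df0 e0.
have := cvgr_lt (lim ((fun h => h^-1 *: ((f \o shift t) (h *: 1) - f t)) @ 0^'))%classic cf.
rewrite -/(derive f t 1) fE => /(_ _ _ df0).
move=> /nbhs_ballP[d /= d0] /(_ (Num.min d e / 2)).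
have m0 : 0 < Num.min d e by rewrite lt_min d0.
have [md me] : Num.min d e <= d /\ Num.min d e <= e by rewrite !ge_min !lexx orbT.
move: (Num.min d e) m0 md me => m m0 md me.
rewrite /ball/= sub0r normrN gtr0_norm; last by lra.
move=> H; exists (t + m / 2); first by lra.
have := H _ _; rewrite /= /GRing.scale/= mulr1 pmulr_rlt0 ?invr_gt0; last by lra.
rewrite subr_lt0 [_ + t]addrC; apply; first by lra.
by rewrite gt_eqF//; lra.
Qed.

(* If [f 1 >= f 0], then [f] takes a value [y] outside of [s] strictly between
   some [f z < f 0] and [f 1]; it cannot decrease at its last passage at [y]. *)
Lemma decrease_off_finite f (s : seq R) :
  (forall t, 0 <= t <= 1 -> {for t, continuous f}) ->
  (forall t, 0 <= t <= 1 ->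
     f t \in s \/ exists2 df, is_derive t 1 f df & df < 0) ->
  (exists2 df, is_derive (0 : R) 1 f df & df < 0) ->
  f 1 < f 0.
Proof.
move=> cf ds [df0 hdf0 df0_lt0]; rewrite ltNge; apply/negP => f01.
have [z /andP[z0]] := derive_lt0_right hdf0 df0_lt0 ltr01.
rewrite add0r => z1 fz.
have [y /andP[fzy yf1] ys] := open_interval_notin s (lt_le_trans fz f01).
pose A := [set t : R | z <= t <= 1 /\ f t <= y]%classic.
have Az : A z by split; [rewrite lexx ltW|exact: ltW].
have A1 : ubound A 1 by move=> t [/andP[]].
have supA : has_sup A by split; [exists z|exists 1].
set m := sup A.
have zm : z <= m by apply: ub_le_sup => //; exists 1.
have m1 : m <= 1 by apply: ge_sup => //; exists z.
have m01 : 0 <= m <= 1 by rewrite m1 andbT (le_trans _ zm)// ltW.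
(* The supremum satisfies the bound itself: otherwise [f > y] near [m], although [A] has points
   arbitrarily close to [m]. *)
have fm : f m <= y.
  rewrite leNgt; apply/negP => yfm.
  have [e /= e0 he] := (nbhs_ballP _ _).1 (cvgr_gt _ (cf m m01) _ yfm).
  have [t At mt] := sup_adherent e0 supA.
  have tm : t <= m by apply: ub_le_sup => //; exists 1.
  have yft : y < f t.
    by apply: he; rewrite /ball/= ger0_norm ?subr_ge0//; rewrite -/m in mt; lra.
  by case: At => _; rewrite leNgt yft.
have m_lt1 : m < 1.
  by rewrite lt_neqAle m1 andbT; apply: contraTneq yf1 => <-; rewrite -leNgt.
have fgt t : m < t -> t <= 1 -> y < f t.
  move=> mt t1; rewrite ltNge; apply/negP => fty.
  have : t <= m by apply: ub_le_sup; [exists 1|split=> //; rewrite t1 andbT; lra].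
  by rewrite leNgt mt.
(* If [f m = y], the derivative at [m] is negative because [y] is not in [s]; if [f m < y],
   continuity is enough. Either way [f] lies below [y] just after [m], against [fgt]. *)
have [fmy|fmy|fmy] := ltgtP (f m) y; last 2 first.
- by move: fm; rewrite leNgt fmy.
- have [fs|[df hdf df_lt0]] := ds m m01; first by rewrite -fmy fs in ys.
  have m1' : 0 < 1 - m by rewrite subr_gt0.
  have [t /andP[mt t1]] := derive_lt0_right hdf df_lt0 m1'.
  by rewrite fmy ltNge ltW// fgt//; lra.
- have [e /= e0 he] := (nbhs_ballP _ _).1 (cvgr_lt _ (cf m m01) _ fmy).
  pose d := Num.min e (1 - m) / 2.
  have d0 : 0 < Num.min e (1 - m) by rewrite lt_min e0 subr_gt0.
  have [de d1] : Num.min e (1 - m) <= e /\ Num.min e (1 - m) <= 1 - m.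
    by rewrite !ge_min !lexx orbT.
  have : f (m + d) < y.
    by apply: he; rewrite /ball/= opprD addNKr normrN gtr0_norm /d; lra.
  by rewrite ltNge ltW// fgt// /d; lra.
Qed.

End decrease_off_finite.

(** * Definiteness of the Jacobian of the angles *)

Section radical_center.
Context {R : realFieldType}.

(* Up to a positive factor, the signed distance from the radical center of the
   three circles to the side opposite to the vertex [1], with [c], [s] the
   hyperbolic cosines and sines of the radii; the Euclidean case is [c = 1] and
   [s = r]. *)
Definition height (c1 c2 c3 s1 s2 s3 I1 I2 I3 : R) : R :=
  c1 * s2 * s3 * (1 - I1 ^+ 2) + c2 * s1 * s3 * (I3 + I1 * I2)
  + c3 * s1 * s2 * (I2 + I1 * I3).

(* Hence at most one of the three edge weights below is negative. *)
Lemma height_ge0 (c1 c2 c3 s1 s2 s3 I1 I2 I3 : R) :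
  0 < c1 -> 0 < c2 -> 0 < c3 -> 0 < s1 -> 0 < s2 -> 0 < s3 ->
  0 <= I1 -> 0 <= I2 -> 0 <= I3 ->
  0 <= height c1 c2 c3 s1 s2 s3 I1 I2 I3 \/
  0 <= height c2 c1 c3 s2 s1 s3 I2 I1 I3.
Proof.
move=> c1_gt0 c2_gt0 c3_gt0 s1_gt0 s2_gt0 s3_gt0 I1_ge0 I2_ge0 I3_ge0.
set h1 := height _ _ _ _ _ _ I1 _ _; set h2 := height _ _ _ _ _ _ _ _ _.
have [|h1lt0] := leP 0 h1; first by left.
have [|h2lt0] := leP 0 h2; first by right.
have x0 : 0 < c1 * s2 * s3 by rewrite !mulr_gt0.
have y0 : 0 < c2 * s1 * s3 by rewrite !mulr_gt0.
have z1 : 0 <= c3 * s1 * s2 * (I2 + I1 * I3).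
  by rewrite !(mulr_ge0, addr_ge0)// ltW.
have z2 : 0 <= c3 * s2 * s1 * (I1 + I2 * I3).
  by rewrite !(mulr_ge0, addr_ge0)// ltW.
move: h1lt0 h2lt0 z1 z2; rewrite /h1 /h2 /height; move: x0 y0.
move: (c1 * s2 * s3) (c2 * s1 * s3) (c3 * s1 * s2 * (I2 + I1 * I3))
  (c3 * s2 * s1 * (I1 + I2 * I3)) => x y z1 z2 x0 y0 h1_lt0 h2_lt0 z10 z20.
exfalso.
have yI3 : 0 <= y * I3 by rewrite mulr_ge0// ltW.
have xI3 : 0 <= x * I3 by rewrite mulr_ge0// ltW.
have I12 : 0 <= I1 * I2 by rewrite mulr_ge0.
(* With the nonnegative terms dropped, the product of these two inequalities gives [(I1 * I2) ^+ 2 <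
   (I1 ^+ 2 - 1) * (I2 ^+ 2 - 1)], which is impossible when both factors on the right are
   positive. *)
have a1 : y * (I1 * I2) < x * (I1 ^+ 2 - 1) by lra.
have a2 : x * (I1 * I2) < y * (I2 ^+ 2 - 1) by lra.
have b1 : 0 <= y * (I1 * I2) by rewrite mulr_ge0// ltW.
have b2 : 0 <= x * (I1 * I2) by rewrite mulr_ge0// ltW.
have := ltr_pM b1 b2 a1 a2.
have -> : y * (I1 * I2) * (x * (I1 * I2)) = (x * y) * (I1 * I2) ^+ 2 by ring.
have -> : x * (I1 ^+ 2 - 1) * (y * (I2 ^+ 2 - 1)) =
  (x * y) * ((I1 ^+ 2 - 1) * (I2 ^+ 2 - 1)) by ring.
rewrite ltr_pM2l ?mulr_gt0//.
have d1 : 0 < I1 ^+ 2 - 1 by rewrite -(pmulr_rgt0 _ x0); exact: le_lt_trans a1.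
have d2 : 0 < I2 ^+ 2 - 1 by rewrite -(pmulr_rgt0 _ y0); exact: le_lt_trans a2.
by nra.
Qed.

End radical_center.

(** * The quadratic form of a hyperbolic triangle *)

Section hyperbolic_form.
Context {R : realFieldType}.

(* For side lengths with hyperbolic cosines [C1], [C2], [C3], the cosine of the
   angle at [1] is [p / Num.sqrt q] with [p = C2 * C3 - C1] and
   [q = (C2 ^+ 2 - 1) * (C3 ^+ 2 - 1)]; this is [dp - p * dq / (2 * q)]. *)
Definition hyp_dangle (C1 C2 C3 dC1 dC2 dC3 : R) : R :=
  dC2 * C3 + C2 * dC3 - dC1 -
  (C2 * C3 - C1) * (C2 * dC2 / (C2 ^+ 2 - 1) + C3 * dC3 / (C3 ^+ 2 - 1)).

(** The Gram determinant of the three vertices on the hyperboloid. It equals [q - p ^+ 2] at each of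
    the three angles, so it is positive exactly when their cosines lie strictly between [-1] and
    [1]. *)
Definition gram (C1 C2 C3 : R) : R :=
  1 + 2 * C1 * C2 * C3 - C1 ^+ 2 - C2 ^+ 2 - C3 ^+ 2.

(** Divided by [C1 ^+ 2 - 1], this is the weight of the side opposite to the vertex [1]; by
    [hyp_weightE] it is a positive multiple of [height]. *)
Definition hyp_weight (C1 C2 C3 c1 c2 c3 : R) : R :=
  c1 * (1 - C1 ^+ 2) + c2 * (C1 * C2 - C3) + c3 * (C1 * C3 - C2).

(* Completing squares twice; [w1 ^+ 2] is subtracted from a principal minor, so
   [0 <= p3] already forces [0 < p3]. *)
Lemma sylvester3 (p1 p2 p3 w1 w2 w3 v1 v2 v3 : R) :
  0 <= p3 -> 0 < p2 * p3 - w1 ^+ 2 ->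
  0 < p1 * p2 * p3 - 2 * w1 * w2 * w3 -
    p1 * w1 ^+ 2 - p2 * w2 ^+ 2 - p3 * w3 ^+ 2 ->
  [|| v1 != 0, v2 != 0 | v3 != 0] ->
  0 < p1 * v1 ^+ 2 + p2 * v2 ^+ 2 + p3 * v3 ^+ 2 -
    2 * (w1 * v2 * v3 + w2 * v1 * v3 + w3 * v1 * v2).
Proof.
move=> p3_ge0 m_gt0 det_gt0 v_neq0.
set D := (X in 0 < X) in det_gt0; set m := (X in 0 < X) in m_gt0.
have p3_gt0 : 0 < p3.
  rewrite lt_neqAle p3_ge0 andbT; apply: contraTneq m_gt0 => p30.
  by rewrite -leNgt /m -p30 mulr0 sub0r oppr_le0 sqr_ge0.
set Q := (X in 0 < X).
have E : p3 * m * Q = m * (p3 * v3 - w1 * v2 - w2 * v1) ^+ 2 +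
    ((m * v2 - (p3 * w3 + w1 * w2) * v1) ^+ 2 + p3 * D * v1 ^+ 2).
  by rewrite /Q /m /D; ring.
have pm : 0 < p3 * m by rewrite mulr_gt0.
rewrite -(pmulr_rgt0 _ pm) E.
have [v1_eq0|v1_neq0] := eqVneq v1 0; last first.
  apply: ltr_wpDl; first by rewrite mulr_ge0 ?sqr_ge0// ltW.
  apply: ltr_wpDl; first exact: sqr_ge0.
  have v12 : 0 < v1 ^+ 2 by rewrite exprn_even_gt0.
  exact: mulr_gt0 (mulr_gt0 p3_gt0 det_gt0) v12.
move: v_neq0; rewrite v1_eq0 eqxx/= !mulr0 !subr0 expr0n mulr0 addr0.
have [->/= v3_neq0|v2_neq0 _] := eqVneq v2 0.
  have pv : 0 < (p3 * v3) ^+ 2 by rewrite exprn_even_gt0// mulf_neq0// gt_eqF.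
  have := mulr_gt0 m_gt0 pv.
  by rewrite !mulr0 subr0 expr0n addr0.
apply: ltr_wpDl; first by rewrite mulr_ge0 ?sqr_ge0// ltW.
have : 0 < (m * v2) ^+ 2 by rewrite exprn_even_gt0// mulf_neq0// gt_eqF.
by [].
Qed.

(* [C1 * c2 - c3] is the derivative of [cosh] of the side [1] along the vertex
   [2].  The quadratic form is the sum over the sides of
   [w1 * (C1 * (v2 ^+ 2 + v3 ^+ 2) - 2 * v2 * v3)], and its minor and its
   determinant factor through [gram], which gives positivity as soon as two of
   the weights are nonnegative. *)
Lemma hyp_form_gt0_weights (C1 C2 C3 c1 c2 c3 v1 v2 v3 : R) :
  1 < C1 -> 1 < C2 -> 1 < C3 -> 0 < c1 -> 0 < gram C1 C2 C3 ->
  0 < C1 * c2 - c3 -> 0 < C1 * c3 - c2 -> 0 < C2 * c1 - c3 ->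
  0 < C2 * c3 - c1 -> 0 < C3 * c1 - c2 -> 0 < C3 * c2 - c1 ->
  0 <= hyp_weight C1 C2 C3 c1 c2 c3 -> 0 <= hyp_weight C2 C1 C3 c2 c1 c3 ->
  [|| v1 != 0, v2 != 0 | v3 != 0] ->
  let dC1 := (C1 * c2 - c3) * v2 + (C1 * c3 - c2) * v3 in
  let dC2 := (C2 * c1 - c3) * v1 + (C2 * c3 - c1) * v3 in
  let dC3 := (C3 * c1 - c2) * v1 + (C3 * c2 - c1) * v2 in
  0 < v1 * hyp_dangle C1 C2 C3 dC1 dC2 dC3 +
      v2 * hyp_dangle C2 C1 C3 dC2 dC1 dC3 +
      v3 * hyp_dangle C3 C1 C2 dC3 dC1 dC2.
Proof.
move=> C1_gt1 C2_gt1 C3_gt1 c1_gt0 G_gt0 a0 b0 c0 d0 e0 f0 W1_ge0 W2_ge0 v0 /=.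
have S1 : 0 < C1 ^+ 2 - 1 by nra.
have S2 : 0 < C2 ^+ 2 - 1 by nra.
have S3 : 0 < C3 ^+ 2 - 1 by nra.
set W1 := hyp_weight _ _ _ c1 _ _ in W1_ge0.
set W2 := hyp_weight _ _ _ _ _ _ in W2_ge0.
pose w1 := W1 / (C1 ^+ 2 - 1); pose w2 := W2 / (C2 ^+ 2 - 1).
pose w3 := hyp_weight C3 C1 C2 c3 c1 c2 / (C3 ^+ 2 - 1).
(* The Jacobian determinant of the three [cosh] side lengths in the coordinates [u]: with zero
   diagonal, only the two cyclic products remain, and both are positive. *)
set D := (C1 * c2 - c3) * (C2 * c3 - c1) * (C3 * c1 - c2) +
  (C1 * c3 - c2) * (C2 * c1 - c3) * (C3 * c2 - c1).
have D_gt0 : 0 < D by rewrite addr_gt0// !mulr_gt0.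
have S_gt0 : 0 < (C1 ^+ 2 - 1) * (C2 ^+ 2 - 1) * (C3 ^+ 2 - 1).
  by rewrite !mulr_gt0.
have w1_ge0 : 0 <= w1 by rewrite divr_ge0// ltW.
have w2_ge0 : 0 <= w2 by rewrite divr_ge0// ltW.
have [C1_gt0 C2_gt0 C3_gt0] : [/\ 0 < C1, 0 < C2 & 0 < C3] by split; lra.
rewrite [X in 0 < X](_ : _ = (C2 * w2 + C3 * w3) * v1 ^+ 2 +
  (C1 * w1 + C3 * w3) * v2 ^+ 2 + (C1 * w1 + C2 * w2) * v3 ^+ 2 -
  2 * (w1 * v2 * v3 + w2 * v1 * v3 + w3 * v1 * v2)); last first.
  rewrite /hyp_dangle /w1 /w2 /w3 /W1 /W2 /hyp_weight; field.
  by rewrite !gt_eqF.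
(* The two nonnegative weights give [0 <= p3], and one of them makes the numerator of the minor
   positive; the determinant is positive whatever the signs of the weights. *)
apply: sylvester3 => //.
- by rewrite addr_ge0// mulr_ge0// ltW.
- have -> : (C1 * w1 + C3 * w3) * (C1 * w1 + C2 * w2) - w1 ^+ 2 =
    gram C1 C2 C3 * ((C2 * c3 - c1) * (C3 * c2 - c1) * W1 + C2 * C3 * D) /
      (c1 * ((C1 ^+ 2 - 1) * (C2 ^+ 2 - 1) * (C3 ^+ 2 - 1))).
    rewrite /w1 /w2 /w3 /W1 /W2 /gram /D /hyp_weight; field.
    by rewrite !gt_eqF.
  rewrite divr_gt0 ?mulr_gt0// ltr_wpDl ?mulr_ge0 ?mulr_gt0// ltW//.
- rewrite [X in 0 < X](_ : _ = gram C1 C2 C3 ^+ 2 * D /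
      ((C1 ^+ 2 - 1) * (C2 ^+ 2 - 1) * (C3 ^+ 2 - 1))); last first.
    rewrite /w1 /w2 /w3 /W1 /W2 /gram /D /hyp_weight; field.
    by rewrite !gt_eqF.
  by rewrite divr_gt0// mulr_gt0// exprn_gt0.
Qed.

Lemma hyp_weightE c1 c2 c3 s1 s2 s3 I1 I2 I3 :
  c1 ^+ 2 - s1 ^+ 2 = 1 -> c2 ^+ 2 - s2 ^+ 2 = 1 -> c3 ^+ 2 - s3 ^+ 2 = 1 ->
  hyp_weight (c2 * c3 + I1 * s2 * s3) (c1 * c3 + I2 * s1 * s3)
    (c1 * c2 + I3 * s1 * s2) c1 c2 c3 =
  s2 * s3 * height c1 c2 c3 s1 s2 s3 I1 I2 I3.
Proof.
move=> k1 k2 k3; set C1 := c2 * c3 + _; set C2 := c1 * c3 + _; set C3 := c1 * c2 + _.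
(* Homogenized by means of [c ^+ 2 - s ^+ 2 = 1], the identity holds in any ring. *)
transitivity (c1 * ((c2 ^+ 2 - s2 ^+ 2) * (c3 ^+ 2 - s3 ^+ 2) - C1 ^+ 2) +
  c2 * (C1 * C2 - C3 * (c3 ^+ 2 - s3 ^+ 2)) +
  c3 * (C1 * C3 - C2 * (c2 ^+ 2 - s2 ^+ 2))).
  by rewrite k2 k3 !mulr1.
by rewrite /C1 /C2 /C3 /height; ring.
Qed.

(** By [height_ge0], each pair of sides contains one with nonnegative weight, so two of the three
    weights are nonnegative. Relabelling the vertices reduces every case to
    [hyp_form_gt0_weights]. *)
Lemma hyp_form_gt0 (c1 c2 c3 s1 s2 s3 I1 I2 I3 v1 v2 v3 : R) :
  0 < c1 -> 0 < c2 -> 0 < c3 -> 0 < s1 -> 0 < s2 -> 0 < s3 ->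
  c1 ^+ 2 - s1 ^+ 2 = 1 -> c2 ^+ 2 - s2 ^+ 2 = 1 -> c3 ^+ 2 - s3 ^+ 2 = 1 ->
  0 <= I1 -> 0 <= I2 -> 0 <= I3 ->
  let C1 := c2 * c3 + I1 * s2 * s3 in
  let C2 := c1 * c3 + I2 * s1 * s3 in
  let C3 := c1 * c2 + I3 * s1 * s2 in
  0 < gram C1 C2 C3 ->
  [|| v1 != 0, v2 != 0 | v3 != 0] ->
  let dC1 := (C1 * c2 - c3) * v2 + (C1 * c3 - c2) * v3 in
  let dC2 := (C2 * c1 - c3) * v1 + (C2 * c3 - c1) * v3 in
  let dC3 := (C3 * c1 - c2) * v1 + (C3 * c2 - c1) * v2 in
  0 < v1 * hyp_dangle C1 C2 C3 dC1 dC2 dC3 +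
      v2 * hyp_dangle C2 C1 C3 dC2 dC1 dC3 +
      v3 * hyp_dangle C3 C1 C2 dC3 dC1 dC2.
Proof.
move=> c1_gt0 c2_gt0 c3_gt0 s1_gt0 s2_gt0 s3_gt0 k1 k2 k3 I1_ge0 I2_ge0 I3_ge0.
move=> C1 C2 C3 G_gt0 v_neq0 /=.
have c_gt1 (c s : R) : 0 < c -> 0 < s -> c ^+ 2 - s ^+ 2 = 1 -> 1 < c by move=> *; nra.
have C_gt1 (c c' s s' I : R) : 0 < c -> 0 < c' -> 0 < s -> 0 < s' -> 0 <= I ->
    c ^+ 2 - s ^+ 2 = 1 -> c' ^+ 2 - s' ^+ 2 = 1 -> 1 < c * c' + I * s * s'.
  move=> c0 c'0 s0 s'0 I0 k k'; rewrite ltr_wpDr ?mulr_ge0// ?(ltW s0)// ?(ltW s'0)//.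
  exact: mulr_egt1 (c_gt1 _ _ c0 s0 k) (c_gt1 _ _ c'0 s'0 k').
(* Multiplying the subtracted [c'] by [c ^+ 2 - s ^+ 2 = 1] cancels the only negative term. *)
have slope_gt0 (c c' s s' I : R) : 0 < c -> 0 < c' -> 0 < s -> 0 < s' -> 0 <= I ->
    c ^+ 2 - s ^+ 2 = 1 -> 0 < (c * c' + I * s * s') * c - c'.
  move=> c0 c'0 s0 s'0 I0 k.
  have -> : (c * c' + I * s * s') * c - c' = s * (c' * s + I * c * s').
    by rewrite -{2}[c']mul1r -k; ring.
  by rewrite mulr_gt0// ltr_wpDr// ?mulr_ge0// ?mulr_gt0// ltW.
have C1_gt1 : 1 < C1 by exact: C_gt1.
have C2_gt1 : 1 < C2 by exact: C_gt1.
have C3_gt1 : 1 < C3 by exact: C_gt1.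
have a0 : 0 < C1 * c2 - c3 by exact: slope_gt0.
have b0 : 0 < C1 * c3 - c2.
  by rewrite /C1 [c2 * c3]mulrC [I1 * _ * _]mulrAC; exact: slope_gt0.
have c0 : 0 < C2 * c1 - c3 by exact: slope_gt0.
have d0 : 0 < C2 * c3 - c1.
  by rewrite /C2 [c1 * c3]mulrC [I2 * _ * _]mulrAC; exact: slope_gt0.
have e0 : 0 < C3 * c1 - c2 by exact: slope_gt0.
have f0 : 0 < C3 * c2 - c1.
  by rewrite /C3 [c1 * c2]mulrC [I3 * _ * _]mulrAC; exact: slope_gt0.
have W1E : hyp_weight C1 C2 C3 c1 c2 c3 = s2 * s3 * height c1 c2 c3 s1 s2 s3 I1 I2 I3.
  exact: hyp_weightE.
have W2E : hyp_weight C2 C1 C3 c2 c1 c3 = s1 * s3 * height c2 c1 c3 s2 s1 s3 I2 I1 I3.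
  by rewrite -hyp_weightE// /C1 /C2 /C3 /hyp_weight; ring.
have W3E : hyp_weight C3 C1 C2 c3 c1 c2 = s1 * s2 * height c3 c1 c2 s3 s1 s2 I3 I1 I2.
  by rewrite -hyp_weightE// /hyp_weight /C1 /C2 /C3; ring.
have W_ge0 (i j h : R) : 0 < i -> 0 < j -> 0 <= h -> 0 <= i * j * h.
  by move=> i0 j0 h0; rewrite mulr_ge0// mulr_ge0// ltW.
have W12 : 0 <= hyp_weight C1 C2 C3 c1 c2 c3 \/ 0 <= hyp_weight C2 C1 C3 c2 c1 c3.
  have [h|h] := height_ge0 c1_gt0 c2_gt0 c3_gt0 s1_gt0 s2_gt0 s3_gt0 I1_ge0 I2_ge0 I3_ge0.
    by left; rewrite W1E W_ge0.
  by right; rewrite W2E W_ge0.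
have weightC D1 D2 D3 d1 d2 d3 : hyp_weight D1 D2 D3 d1 d2 d3 = hyp_weight D1 D3 D2 d1 d3 d2.
  by rewrite /hyp_weight; ring.
have W13 : 0 <= hyp_weight C1 C2 C3 c1 c2 c3 \/ 0 <= hyp_weight C3 C1 C2 c3 c1 c2.
  have [h|h] := height_ge0 c1_gt0 c3_gt0 c2_gt0 s1_gt0 s3_gt0 s2_gt0 I1_ge0 I3_ge0 I2_ge0.
    left; rewrite W1E W_ge0//; move: h; congr (0 <= _); rewrite /height; ring.
  by right; rewrite W3E W_ge0.
have W23 : 0 <= hyp_weight C2 C1 C3 c2 c1 c3 \/ 0 <= hyp_weight C3 C1 C2 c3 c1 c2.
  have [h|h] := height_ge0 c2_gt0 c3_gt0 c1_gt0 s2_gt0 s3_gt0 s1_gt0 I2_ge0 I3_ge0 I1_ge0.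
    left; rewrite W2E W_ge0//; move: h; congr (0 <= _); rewrite /height; ring.
  right; rewrite W3E W_ge0//; move: h; congr (0 <= _); rewrite /height; ring.
have [[W1 W2]|[[W1 W3]|[W2 W3]]] :
    (0 <= hyp_weight C1 C2 C3 c1 c2 c3 /\ 0 <= hyp_weight C2 C1 C3 c2 c1 c3) \/
    ((0 <= hyp_weight C1 C2 C3 c1 c2 c3 /\ 0 <= hyp_weight C3 C1 C2 c3 c1 c2) \/
    (0 <= hyp_weight C2 C1 C3 c2 c1 c3 /\ 0 <= hyp_weight C3 C1 C2 c3 c1 c2)).
  by tauto.
- exact: (hyp_form_gt0_weights C1_gt1 C2_gt1 C3_gt1 c1_gt0 G_gt0 a0 b0 c0 d0 e0 f0 W1 W2 v_neq0).
- have G' : 0 < gram C1 C3 C2 by rewrite (_ : gram _ _ _ = gram C1 C2 C3)// /gram; ring.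
  have v' : [|| v1 != 0, v3 != 0 | v2 != 0] by rewrite [_ || (v2 != 0)]orbC.
  rewrite weightC in W1.
  have := hyp_form_gt0_weights C1_gt1 C3_gt1 C2_gt1 c1_gt0 G' b0 a0 e0 f0 c0 d0 W1 W3 v'.
  by congr (0 < _); rewrite /= /hyp_dangle; ring.
- have G' : 0 < gram C2 C3 C1 by rewrite (_ : gram _ _ _ = gram C1 C2 C3)// /gram; ring.
  have v' : [|| v2 != 0, v3 != 0 | v1 != 0] by rewrite orbA orbC.
  rewrite weightC in W2; rewrite weightC in W3.
  have := hyp_form_gt0_weights C2_gt1 C3_gt1 C1_gt1 c2_gt0 G' d0 c0 f0 e0 a0 b0 W2 W3 v'.
  by congr (0 < _); rewrite /= /hyp_dangle; ring.
Qed.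

End hyperbolic_form.

(** * The quadratic form of a Euclidean triangle *)

Section euclidean_form.
Context {R : realFieldType}.

(* The analogue of [hyp_dangle] for squared side lengths [L1], [L2], [L3], with
   [p = L2 + L3 - L1] and [q = 4 * L2 * L3]. *)
Definition euc_dangle (L1 L2 L3 dL1 dL2 dL3 : R) : R :=
  dL2 + dL3 - dL1 - (L2 + L3 - L1) * (dL2 / L2 + dL3 / L3) / 2.

(** Sixteen times the squared area, by Heron's formula; it is [q - p ^+ 2] at each of the three
    angles. *)
Definition heron (L1 L2 L3 : R) : R := 4 * L2 * L3 - (L2 + L3 - L1) ^+ 2.

(** Here [y1], [y2], [y3] stand for the squared radii; by [euc_weightE] this is then a positive
    multiple of [height] with all [c] equal to [1]. *)
Definition euc_weight (L1 L2 L3 y1 y2 y3 : R) : R :=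
  (L1 * (L2 + L3 - L1) - 2 * L1 * y1 +
   y2 * (L1 + L2 - L3) + y3 * (L1 + L3 - L2)) / 2.

(** The third weight may be negative: multiplied by [w1 + w2 > 0], the form becomes a square plus
    [m * (x1 + x2) ^+ 2], where [m] is the principal minor of the Laplacian of a triangle graph. *)
Lemma laplacian3_gt0 (w1 w2 w3 x1 x2 x3 : R) :
  0 <= w1 -> 0 <= w2 -> 0 < w1 * w2 + w3 * (w1 + w2) ->
  x1 + x2 = x3 -> (x1 != 0) || (x2 != 0) ->
  0 < w1 * x1 ^+ 2 + w2 * x2 ^+ 2 + w3 * x3 ^+ 2.
Proof.
move=> w1_ge0 w2_ge0 m_gt0 <- x_neq0; set m := (X in 0 < X) in m_gt0.
have w12 : 0 < w1 + w2.
  rewrite lt_neqAle addr_ge0// andbT; apply: contraTneq m_gt0 => w0.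
  have w10 : w1 = 0 by lra.
  by rewrite /m -w0 w10 mul0r mulr0 addr0 ltxx.
set Q := (X in 0 < X).
have E : (w1 + w2) * Q = (w1 * x1 - w2 * x2) ^+ 2 + m * (x1 + x2) ^+ 2.
  by rewrite /Q /m; ring.
rewrite -(pmulr_rgt0 _ w12) E.
have [x0|x0] := eqVneq (x1 + x2) 0; last first.
  apply: ltr_wpDl; first exact: sqr_ge0.
  by apply: mulr_gt0 => //; rewrite exprn_even_gt0.
have x2E : x2 = - x1 by lra.
have x1_neq0 : x1 != 0 by move: x_neq0; rewrite x2E oppr_eq0 orbb.
apply: ltr_wpDr; first by rewrite mulr_ge0 ?sqr_ge0// ltW.
have -> : w1 * x1 - w2 * x2 = (w1 + w2) * x1 by rewrite x2E; ring.
by rewrite exprn_even_gt0// mulf_neq0// gt_eqF.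
Qed.

(* [a], ..., [f] are half the derivatives of the squared side lengths along the
   vertices; here the quadratic form is a graph Laplacian. *)
Lemma euc_form_gt0_weights (L1 L2 L3 y1 y2 y3 v1 v2 v3 : R) :
  0 < L1 -> 0 < L2 -> 0 < L3 -> 0 < heron L1 L2 L3 ->
  let a := (L1 + y2 - y3) / 2 in let b := (L1 + y3 - y2) / 2 in
  let c := (L2 + y1 - y3) / 2 in let d := (L2 + y3 - y1) / 2 in
  let e := (L3 + y1 - y2) / 2 in let f := (L3 + y2 - y1) / 2 in
  0 < a -> 0 < b -> 0 < c -> 0 < d -> 0 < e -> 0 < f ->
  0 <= euc_weight L1 L2 L3 y1 y2 y3 -> 0 <= euc_weight L2 L1 L3 y2 y1 y3 ->
  (v1 != v2) || (v1 != v3) ->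
  0 < v1 * euc_dangle L1 L2 L3
        (2 * (a * v2 + b * v3)) (2 * (c * v1 + d * v3)) (2 * (e * v1 + f * v2)) +
      v2 * euc_dangle L2 L1 L3
        (2 * (c * v1 + d * v3)) (2 * (a * v2 + b * v3)) (2 * (e * v1 + f * v2)) +
      v3 * euc_dangle L3 L1 L2
        (2 * (e * v1 + f * v2)) (2 * (a * v2 + b * v3)) (2 * (c * v1 + d * v3)).
Proof.
move=> L1_gt0 L2_gt0 L3_gt0 G_gt0 a b c d e f a0 b0 c0 d0 e0 f0 W1_ge0 W2_ge0 v_neq.
set W1 := euc_weight _ _ _ y1 _ _ in W1_ge0.
set W2 := euc_weight _ _ _ _ _ _ in W2_ge0.
pose w1 := W1 / L1; pose w2 := W2 / L2; pose w3 := euc_weight L3 L1 L2 y3 y1 y2 / L3.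
(* The determinant of the matrix of half derivatives of the squared side lengths; it is a factor of
   the minor required by [laplacian3_gt0]. *)
set D := a * d * e + b * c * f.
have D_gt0 : 0 < D.
  exact: addr_gt0 (mulr_gt0 (mulr_gt0 a0 d0) e0) (mulr_gt0 (mulr_gt0 b0 c0) f0).
rewrite [X in 0 < X](_ : _ = w1 * (v3 - v2) ^+ 2 + w2 * (v1 - v3) ^+ 2 +
    w3 * (v1 - v2) ^+ 2); last first.
  rewrite /euc_dangle /w1 /w2 /w3 /W1 /W2 /euc_weight /a /b /c /d /e /f; field.
  by rewrite !gt_eqF.
apply: laplacian3_gt0.
- by rewrite divr_ge0// ltW.
- by rewrite divr_ge0// ltW.
- rewrite [X in 0 < X](_ : _ = heron L1 L2 L3 * D / (L1 * L2 * L3)); last first.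
    rewrite /w1 /w2 /w3 /W1 /W2 /heron /D /euc_weight /a /b /c /d /e /f; field.
    by rewrite !gt_eqF.
  by rewrite divr_gt0// !mulr_gt0.
- by ring.
- rewrite !subr_eq0; apply: contraTT v_neq.
  by rewrite !negb_or !negbK => /andP[/eqP-> /eqP->]; rewrite eqxx.
Qed.

Lemma euc_weightE r1 r2 r3 I1 I2 I3 :
  euc_weight (r2 ^+ 2 + r3 ^+ 2 + 2 * r2 * r3 * I1)
    (r1 ^+ 2 + r3 ^+ 2 + 2 * r1 * r3 * I2) (r1 ^+ 2 + r2 ^+ 2 + 2 * r1 * r2 * I3)
    (r1 ^+ 2) (r2 ^+ 2) (r3 ^+ 2) =
  2 * r2 * r3 * height 1 1 1 r1 r2 r3 I1 I2 I3.
Proof. by rewrite /euc_weight /height; field. Qed.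

(** As in the hyperbolic case, [height_ge0] leaves at most one negative weight. Constant [v] is
    excluded because it corresponds to a dilation, which preserves the angles. *)
Lemma euc_form_gt0 (r1 r2 r3 I1 I2 I3 v1 v2 v3 : R) :
  0 < r1 -> 0 < r2 -> 0 < r3 -> 0 <= I1 -> 0 <= I2 -> 0 <= I3 ->
  let L1 := r2 ^+ 2 + r3 ^+ 2 + 2 * r2 * r3 * I1 in
  let L2 := r1 ^+ 2 + r3 ^+ 2 + 2 * r1 * r3 * I2 in
  let L3 := r1 ^+ 2 + r2 ^+ 2 + 2 * r1 * r2 * I3 in
  let dL1 := 2 * ((r2 ^+ 2 + r2 * r3 * I1) * v2 + (r3 ^+ 2 + r2 * r3 * I1) * v3) in
  let dL2 := 2 * ((r1 ^+ 2 + r1 * r3 * I2) * v1 + (r3 ^+ 2 + r1 * r3 * I2) * v3) in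
  let dL3 := 2 * ((r1 ^+ 2 + r1 * r2 * I3) * v1 + (r2 ^+ 2 + r1 * r2 * I3) * v2) in
  0 < heron L1 L2 L3 -> (v1 != v2) || (v1 != v3) ->
  0 < v1 * euc_dangle L1 L2 L3 dL1 dL2 dL3 +
      v2 * euc_dangle L2 L1 L3 dL2 dL1 dL3 +
      v3 * euc_dangle L3 L1 L2 dL3 dL1 dL2.
Proof.
move=> r1_gt0 r2_gt0 r3_gt0 I1_ge0 I2_ge0 I3_ge0 L1 L2 L3 dL1 dL2 dL3 G_gt0 v_neq.
have slope_gt0 (x y I : R) : 0 < x -> 0 < y -> 0 <= I -> 0 < x ^+ 2 + x * y * I.
  move=> x0 y0 I0; rewrite ltr_wpDr ?exprn_gt0// !mulr_ge0// ltW//.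
have L_gt0 (x y I : R) : 0 < x -> 0 < y -> 0 <= I -> 0 < x ^+ 2 + y ^+ 2 + 2 * x * y * I.
  move=> x0 y0 I0; rewrite ltr_wpDr ?addr_gt0 ?exprn_gt0// !mulr_ge0// ltW//.
have L1_gt0 : 0 < L1 by exact: L_gt0.
have L2_gt0 : 0 < L2 by exact: L_gt0.
have L3_gt0 : 0 < L3 by exact: L_gt0.
(* The half derivatives are expressed through squared sides and squared radii, the variables of
   [euc_form_gt0_weights]. *)
have aE : (L1 + r2 ^+ 2 - r3 ^+ 2) / 2 = r2 ^+ 2 + r2 * r3 * I1.
  by rewrite /L1; field.
have bE : (L1 + r3 ^+ 2 - r2 ^+ 2) / 2 = r3 ^+ 2 + r2 * r3 * I1.
  by rewrite /L1; field.
have cE : (L2 + r1 ^+ 2 - r3 ^+ 2) / 2 = r1 ^+ 2 + r1 * r3 * I2.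
  by rewrite /L2; field.
have dE : (L2 + r3 ^+ 2 - r1 ^+ 2) / 2 = r3 ^+ 2 + r1 * r3 * I2.
  by rewrite /L2; field.
have eE : (L3 + r1 ^+ 2 - r2 ^+ 2) / 2 = r1 ^+ 2 + r1 * r2 * I3.
  by rewrite /L3; field.
have fE : (L3 + r2 ^+ 2 - r1 ^+ 2) / 2 = r2 ^+ 2 + r1 * r2 * I3.
  by rewrite /L3; field.
have a0 : 0 < (L1 + r2 ^+ 2 - r3 ^+ 2) / 2 by rewrite aE slope_gt0.
have b0 : 0 < (L1 + r3 ^+ 2 - r2 ^+ 2) / 2 by rewrite bE [r2 * r3]mulrC slope_gt0.
have c0 : 0 < (L2 + r1 ^+ 2 - r3 ^+ 2) / 2 by rewrite cE slope_gt0.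
have d0 : 0 < (L2 + r3 ^+ 2 - r1 ^+ 2) / 2 by rewrite dE [r1 * r3]mulrC slope_gt0.
have e0 : 0 < (L3 + r1 ^+ 2 - r2 ^+ 2) / 2 by rewrite eE slope_gt0.
have f0 : 0 < (L3 + r2 ^+ 2 - r1 ^+ 2) / 2 by rewrite fE [r1 * r2]mulrC slope_gt0.
rewrite /dL1 /dL2 /dL3 -aE -bE -cE -dE -eE -fE.
have W1E : euc_weight L1 L2 L3 (r1 ^+ 2) (r2 ^+ 2) (r3 ^+ 2) =
    2 * r2 * r3 * height 1 1 1 r1 r2 r3 I1 I2 I3.
  exact: euc_weightE.
have W2E : euc_weight L2 L1 L3 (r2 ^+ 2) (r1 ^+ 2) (r3 ^+ 2) =
    2 * r1 * r3 * height 1 1 1 r2 r1 r3 I2 I1 I3.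
  by rewrite -euc_weightE /L1 /L2 /L3 /euc_weight; ring.
have W3E : euc_weight L3 L1 L2 (r3 ^+ 2) (r1 ^+ 2) (r2 ^+ 2) =
    2 * r1 * r2 * height 1 1 1 r3 r1 r2 I3 I1 I2.
  by rewrite -euc_weightE /L1 /L2 /L3 /euc_weight; ring.
have W_ge0 (i j h : R) : 0 < i -> 0 < j -> 0 <= h -> 0 <= 2 * i * j * h.
  by move=> i0 j0 h0; rewrite !mulr_ge0// ltW.
have heightC (c1 c2 c3 s1 s2 s3 J1 J2 J3 : R) :
    height c1 c2 c3 s1 s2 s3 J1 J2 J3 = height c1 c3 c2 s1 s3 s2 J1 J3 J2.
  by rewrite /height; ring.
have p1 : 0 < 1 :> R by [].
have W12 : 0 <= euc_weight L1 L2 L3 (r1 ^+ 2) (r2 ^+ 2) (r3 ^+ 2) \/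
    0 <= euc_weight L2 L1 L3 (r2 ^+ 2) (r1 ^+ 2) (r3 ^+ 2).
  have [h|h] := height_ge0 p1 p1 p1 r1_gt0 r2_gt0 r3_gt0 I1_ge0 I2_ge0 I3_ge0.
    by left; rewrite W1E W_ge0.
  by right; rewrite W2E W_ge0.
have W13 : 0 <= euc_weight L1 L2 L3 (r1 ^+ 2) (r2 ^+ 2) (r3 ^+ 2) \/
    0 <= euc_weight L3 L1 L2 (r3 ^+ 2) (r1 ^+ 2) (r2 ^+ 2).
  have [h|h] := height_ge0 p1 p1 p1 r1_gt0 r3_gt0 r2_gt0 I1_ge0 I3_ge0 I2_ge0.
    by left; rewrite W1E W_ge0// heightC.
  by right; rewrite W3E W_ge0.
have W23 : 0 <= euc_weight L2 L1 L3 (r2 ^+ 2) (r1 ^+ 2) (r3 ^+ 2) \/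
    0 <= euc_weight L3 L1 L2 (r3 ^+ 2) (r1 ^+ 2) (r2 ^+ 2).
  have [h|h] := height_ge0 p1 p1 p1 r2_gt0 r3_gt0 r1_gt0 I2_ge0 I3_ge0 I1_ge0.
    by left; rewrite W2E W_ge0// heightC.
  by right; rewrite W3E W_ge0// heightC.
have weightC D1 D2 D3 d1 d2 d3 : euc_weight D1 D2 D3 d1 d2 d3 = euc_weight D1 D3 D2 d1 d3 d2.
  by rewrite /euc_weight; ring.
have [[W1 W2]|[[W1 W3]|[W2 W3]]] :
    (0 <= euc_weight L1 L2 L3 (r1 ^+ 2) (r2 ^+ 2) (r3 ^+ 2) /\
     0 <= euc_weight L2 L1 L3 (r2 ^+ 2) (r1 ^+ 2) (r3 ^+ 2)) \/
    ((0 <= euc_weight L1 L2 L3 (r1 ^+ 2) (r2 ^+ 2) (r3 ^+ 2) /\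
      0 <= euc_weight L3 L1 L2 (r3 ^+ 2) (r1 ^+ 2) (r2 ^+ 2)) \/
     (0 <= euc_weight L2 L1 L3 (r2 ^+ 2) (r1 ^+ 2) (r3 ^+ 2) /\
      0 <= euc_weight L3 L1 L2 (r3 ^+ 2) (r1 ^+ 2) (r2 ^+ 2))).
  by tauto.
- exact: (euc_form_gt0_weights L1_gt0 L2_gt0 L3_gt0 G_gt0 a0 b0 c0 d0 e0 f0 W1 W2 v_neq).
- have G' : 0 < heron L1 L3 L2 by rewrite (_ : heron _ _ _ = heron L1 L2 L3)// /heron; ring.
  have v' : (v1 != v3) || (v1 != v2) by rewrite orbC.
  rewrite weightC in W1.
  have := euc_form_gt0_weights L1_gt0 L3_gt0 L2_gt0 G' b0 a0 e0 f0 c0 d0 W1 W3 v'.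
  by congr (0 < _); rewrite /= /euc_dangle; ring.
- have G' : 0 < heron L2 L3 L1 by rewrite (_ : heron _ _ _ = heron L1 L2 L3)// /heron; ring.
  have v' : (v2 != v3) || (v2 != v1).
    by move: v_neq; rewrite [v2 == v1]eq_sym; have [<-|] := eqVneq v1 v2; rewrite ?orbF ?orbT.
  rewrite weightC in W2; rewrite weightC in W3.
  have := euc_form_gt0_weights L2_gt0 L3_gt0 L1_gt0 G' d0 c0 f0 e0 a0 b0 W2 W3 v'.
  by congr (0 < _); rewrite /= /euc_dangle; ring.
Qed.

End euclidean_form.

(** * Monotonicity of the angles of one triangle *)

Section angle_paths.
Context {R : realType}.
Implicit Types (f g p q : R -> R) (t v x y df dg : R).

Lemma is_derive_const t (k : R) : is_derive t 1 (fun _ : R => k) 0.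
Proof. exact: is_derive_cst. Qed.

Lemma is_derive_mul f g t df dg : is_derive t 1 f df -> is_derive t 1 g dg ->
  is_derive t 1 (fun z => f z * g z) (f t * dg + g t * df).
Proof. by move=> hf hg; exact: (is_deriveM hf hg). Qed.

Lemma is_derive_add f g t df dg : is_derive t 1 f df -> is_derive t 1 g dg ->
  is_derive t 1 (fun z => f z + g z) (df + dg).
Proof. by move=> hf hg; exact: (is_deriveD hf hg). Qed.

Lemma is_derive_sub f g t df dg : is_derive t 1 f df -> is_derive t 1 g dg ->
  is_derive t 1 (fun z => f z - g z) (df - dg).
Proof. by move=> hf hg; exact: (is_deriveB hf hg). Qed.

Lemma is_derive_scale f t (k : R) df : is_derive t 1 f df ->
  is_derive t 1 (fun z => k * f z) (k * df).
Proof. by move=> hf; exact: (is_deriveZ k hf). Qed.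

(** The common value [G] of [q - p ^+ 2] makes the three angles degenerate simultaneously. Where
    [G > 0], the derivative of the sum is the negative of the quadratic form over [sqrt G];
    elsewhere every angle is [0] or [pi], and [decrease_off_finite] applies. *)
Lemma angle_sum_decreases (p1 p2 p3 q1 q2 q3 G : R -> R) (v1 v2 v3 : R) :
  (forall t, 0 <= t <= 1 -> exists dp1 dp2 dp3 dq1 dq2 dq3 : R,
    [/\ [/\ is_derive t 1 p1 dp1, is_derive t 1 p2 dp2 & is_derive t 1 p3 dp3],
        [/\ is_derive t 1 q1 dq1, is_derive t 1 q2 dq2 & is_derive t 1 q3 dq3],
        [/\ 0 < q1 t, 0 < q2 t & 0 < q3 t],
        [/\ q1 t - p1 t ^+ 2 = G t, q2 t - p2 t ^+ 2 = G t & q3 t - p3 t ^+ 2 = G t] &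
        0 < G t -> 0 < v1 * (dp1 - p1 t * dq1 / (2 * q1 t)) +
          v2 * (dp2 - p2 t * dq2 / (2 * q2 t)) + v3 * (dp3 - p3 t * dq3 / (2 * q3 t))]) ->
  0 < G 0 ->
  v1 * angle (p1 1) (q1 1) + v2 * angle (p2 1) (q2 1) + v3 * angle (p3 1) (q3 1) <
  v1 * angle (p1 0) (q1 0) + v2 * angle (p2 0) (q2 0) + v3 * angle (p3 0) (q3 0).
Proof.
move=> path G0.
pose F t := v1 * angle (p1 t) (q1 t) + v2 * angle (p2 t) (q2 t) + v3 * angle (p3 t) (q3 t).
have dF t : 0 <= t <= 1 -> 0 < G t -> exists2 dF, is_derive t 1 F dF & dF < 0.
  move=> /path[dp1 [dp2 [dp3 [dq1 [dq2 [dq3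
    [[hp1 hp2 hp3] [hq1 hq2 hq3] [q1_gt0 q2_gt0 q3_gt0] [E1 E2 E3] Q]]]]]]] Gt.
  have pq1 : p1 t ^+ 2 < q1 t by rewrite -subr_gt0 E1.
  have pq2 : p2 t ^+ 2 < q2 t by rewrite -subr_gt0 E2.
  have pq3 : p3 t ^+ 2 < q3 t by rewrite -subr_gt0 E3.
  have h1 := is_derive_scale v1 (is_derive_angle hp1 hq1 pq1).
  have h2 := is_derive_scale v2 (is_derive_angle hp2 hq2 pq2).
  have h3 := is_derive_scale v3 (is_derive_angle hp3 hq3 pq3).
  eexists; first exact: is_derive_add (is_derive_add h1 h2) h3.
  rewrite E1 E2 E3 !mulrA -!mulrDl pmulr_llt0 ?invr_gt0 ?sqrtr_gt0//.
  by rewrite !mulrN -!opprD oppr_lt0; exact: Q.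
(* The exceptional values are the combinations of [v1], [v2], [v3] with coefficients [0] or [pi]. *)
apply: (@decrease_off_finite _ F [seq x + y | x <- [seq x + y | x <-
    [seq v1 * x | x <- [:: 0; pi]], y <- [seq v2 * x | x <- [:: 0; pi]]],
    y <- [seq v3 * x | x <- [:: 0; pi]]]).
- move=> t /path[dp1 [dp2 [dp3 [dq1 [dq2 [dq3
    [[hp1 hp2 hp3] [hq1 hq2 hq3] [q1_gt0 q2_gt0 q3_gt0] _ _]]]]]]].
  have ca p q dp dq (v : R) : is_derive t 1 p dp -> is_derive t 1 q dq -> 0 < q t ->
      {for t, continuous (fun z => v * angle (p z) (q z))}.
    move=> hp hq q_gt0; apply: cvgM; first exact: cvg_cst.
    exact: angle_continuous (is_derive_continuous hp) (is_derive_continuous hq) q_gt0.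
  by apply: cvgD; [apply: cvgD|]; apply: ca; eassumption.
- move=> t t01; have [Gt|Gt] := ltP 0 (G t); first by right; exact: dF.
  left; have [dp1 [dp2 [dp3 [dq1 [dq2 [dq3
    [_ _ [q1_gt0 q2_gt0 q3_gt0] [E1 E2 E3] _]]]]]]] := path t t01.
  apply: allpairs_f; [apply: allpairs_f|]; apply: map_f; apply: angle_degenerate => //.
  + by rewrite -subr_le0 E1.
  + by rewrite -subr_le0 E2.
  + by rewrite -subr_le0 E3.
- by apply: dF => //; rewrite lexx ler01.
Qed.

(* A straight line in the coordinate [u = ln x]. *)
Definition geodesic x v t := x * expR (v * t).

Lemma is_derive_geodesic x v t :
  is_derive t 1 (geodesic x v) (v * geodesic x v t).
Proof.
have h : is_derive t 1 (fun z => v * z) (v * 1).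
  by apply: is_derive_scale; exact: is_derive_id.
have := is_derive_scale x (is_derive1_comp (is_derive_expR (v * t)) h).
by move=> H; apply: is_derive_eq H _; rewrite /geodesic /GRing.scale/=; ring.
Qed.

Lemma geodesic_gt0 x v t : 0 < x -> 0 < geodesic x v t.
Proof. by move=> x0; rewrite mulr_gt0// expR_gt0. Qed.

Lemma geodesic0 x v : geodesic x v 0 = x.
Proof. by rewrite /geodesic mulr0 expR0 mulr1. Qed.

Lemma geodesic1 x y : 0 < x -> 0 < y -> geodesic x (ln y - ln x) 1 = y.
Proof.
move=> x0 y0; rewrite /geodesic mulr1 expRD expRN !lnK ?posrE//.
by rewrite mulrCA divff ?mulr1// gt_eqF.
Qed.

(** The constraint [tanh (r / 2) < 1] reads [u < 0], which is convex in the coordinate [u]. *)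
Lemma geodesic_lt1 x y t : 0 < x < 1 -> 0 < y < 1 -> 0 <= t <= 1 ->
  geodesic x (ln y - ln x) t < 1.
Proof.
move=> /andP[x0 x1] /andP[y0 y1] /andP[t0 t1].
rewrite /geodesic -{1}[x]lnK ?posrE// -expRD expR_lt1.
have lx : ln x < 0 by apply: ln_lt0; rewrite x0.
have ly : ln y < 0 by apply: ln_lt0; rewrite y0.
by nra.
Qed.

Definition sqlen x y (I : R) : R := x ^+ 2 + y ^+ 2 + 2 * x * y * I.

Lemma sqlen_gt0 x y I : 0 < x -> 0 < y -> 0 <= I -> 0 < sqlen x y I.
Proof.
by move=> x0 y0 I0; rewrite ltr_wpDr ?addr_gt0 ?exprn_gt0// !mulr_ge0// ltW.
Qed.

Lemma is_derive_sqlen f g t v w I :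
  is_derive t 1 f (v * f t) -> is_derive t 1 g (w * g t) ->
  is_derive t 1 (fun z => sqlen (f z) (g z) I)
    (2 * ((f t ^+ 2 + f t * g t * I) * v + (g t ^+ 2 + f t * g t * I) * w)).
Proof.
move=> hf hg; have := is_derive_add
  (is_derive_add (is_derive_mul hf hf) (is_derive_mul hg hg))
  (is_derive_scale (2 * I) (is_derive_mul hf hg)).
rewrite (_ : (fun z => _) = fun z => sqlen (f z) (g z) I).
  by move=> H; apply: is_derive_eq H _; ring.
by apply: funext => z; rewrite /sqlen; ring.
Qed.

Lemma euc_triangle_monotone (x1 x2 x3 y1 y2 y3 I1 I2 I3 : R) :
  0 < x1 -> 0 < x2 -> 0 < x3 -> 0 < y1 -> 0 < y2 -> 0 < y3 ->
  0 <= I1 -> 0 <= I2 -> 0 <= I3 ->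
  let v1 := ln y1 - ln x1 in let v2 := ln y2 - ln x2 in let v3 := ln y3 - ln x3 in
  let L1 := sqlen x2 x3 I1 in let L2 := sqlen x1 x3 I2 in let L3 := sqlen x1 x2 I3 in
  let M1 := sqlen y2 y3 I1 in let M2 := sqlen y1 y3 I2 in let M3 := sqlen y1 y2 I3 in
  0 < heron L1 L2 L3 -> (v1 != v2) || (v1 != v3) ->
  v1 * angle (M2 + M3 - M1) (4 * M2 * M3) +
  v2 * angle (M1 + M3 - M2) (4 * M1 * M3) +
  v3 * angle (M1 + M2 - M3) (4 * M1 * M2) <
  v1 * angle (L2 + L3 - L1) (4 * L2 * L3) +
  v2 * angle (L1 + L3 - L2) (4 * L1 * L3) +
  v3 * angle (L1 + L2 - L3) (4 * L1 * L2).
Proof.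
move=> x1_gt0 x2_gt0 x3_gt0 y1_gt0 y2_gt0 y3_gt0 I1_ge0 I2_ge0 I3_ge0.
move=> v1 v2 v3 L1 L2 L3 M1 M2 M3 G_gt0 v_neq.
pose X1 t := geodesic x1 v1 t; pose X2 t := geodesic x2 v2 t; pose X3 t := geodesic x3 v3 t.
pose l1 t := sqlen (X2 t) (X3 t) I1.
pose l2 t := sqlen (X1 t) (X3 t) I2.
pose l3 t := sqlen (X1 t) (X2 t) I3.
have H := @angle_sum_decreases
  (fun t => l2 t + l3 t - l1 t) (fun t => l1 t + l3 t - l2 t) (fun t => l1 t + l2 t - l3 t)
  (fun t => 4 * l2 t * l3 t) (fun t => 4 * l1 t * l3 t) (fun t => 4 * l1 t * l2 t)
  (fun t => heron (l1 t) (l2 t) (l3 t)) v1 v2 v3.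
have l10 : l1 0 = L1 by rewrite /l1 /X2 /X3 !geodesic0.
have l20 : l2 0 = L2 by rewrite /l2 /X1 /X3 !geodesic0.
have l30 : l3 0 = L3 by rewrite /l3 /X1 /X2 !geodesic0.
have l11 : l1 1 = M1 by rewrite /l1 /X2 /X3 !geodesic1.
have l21 : l2 1 = M2 by rewrite /l2 /X1 /X3 !geodesic1.
have l31 : l3 1 = M3 by rewrite /l3 /X1 /X2 !geodesic1.
rewrite l10 l20 l30 l11 l21 l31 in H; apply: H => // t _.
have X1_gt0 : 0 < X1 t by exact: geodesic_gt0.
have X2_gt0 : 0 < X2 t by exact: geodesic_gt0.
have X3_gt0 : 0 < X3 t by exact: geodesic_gt0.
have l1_gt0 : 0 < l1 t by exact: sqlen_gt0.
have l2_gt0 : 0 < l2 t by exact: sqlen_gt0.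
have l3_gt0 : 0 < l3 t by exact: sqlen_gt0.
have d1 := is_derive_sqlen I1 (is_derive_geodesic x2 v2 t) (is_derive_geodesic x3 v3 t).
have d2 := is_derive_sqlen I2 (is_derive_geodesic x1 v1 t) (is_derive_geodesic x3 v3 t).
have d3 := is_derive_sqlen I3 (is_derive_geodesic x1 v1 t) (is_derive_geodesic x2 v2 t).
rewrite -/(X1 t) -/(X2 t) -/(X3 t) in d1 d2 d3.
do 6!eexists; split; first split.
- exact: is_derive_sub (is_derive_add d2 d3) d1.
- exact: is_derive_sub (is_derive_add d1 d3) d2.
- exact: is_derive_sub (is_derive_add d1 d2) d3.
- split.
  + exact: is_derive_mul (is_derive_scale 4 d2) d3.
  + exact: is_derive_mul (is_derive_scale 4 d1) d3.
  + exact: is_derive_mul (is_derive_scale 4 d1) d2.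
- by split; rewrite !mulr_gt0.
- by split; rewrite /heron; ring.
(* For [q = 4 * L2 * L3] the logarithmic derivative is [dL2 / L2 + dL3 / L3], which turns each
   [dp - p * dq / (2 * q)] into [euc_dangle]. *)
- move=> Gt; have := euc_form_gt0 X1_gt0 X2_gt0 X3_gt0 I1_ge0 I2_ge0 I3_ge0 Gt v_neq.
  rewrite -/(sqlen (X2 t) (X3 t) I1) -/(sqlen (X1 t) (X3 t) I2) -/(sqlen (X1 t) (X2 t) I3).
  rewrite -/(l1 t) -/(l2 t) -/(l3 t) /euc_dangle.
  congr (0 < _); field.
  by rewrite !gt_eqF.
Qed.

End angle_paths.

(** * Paths of hyperbolic triangles *)

Section hyperbolic_paths.
Context {R : realType}.
Implicit Types (f g p q : R -> R) (t v w x y df dg I : R).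

(* [cosh r] and [sinh r] in terms of [x = tanh (r / 2)] *)
Definition hcos x : R := (1 + x ^+ 2) / (1 - x ^+ 2).
Definition hsin x : R := 2 * x / (1 - x ^+ 2).
Definition coshlen x y I : R := hcos x * hcos y + I * hsin x * hsin y.

Lemma hcos_gt0 x : 0 < x < 1 -> 0 < hcos x.
Proof. by move=> /andP[x0 x1]; rewrite divr_gt0//; nra. Qed.

Lemma hsin_gt0 x : 0 < x < 1 -> 0 < hsin x.
Proof. by move=> /andP[x0 x1]; rewrite divr_gt0//; nra. Qed.

Lemma hcos2_hsin2 x : 0 < x < 1 -> hcos x ^+ 2 - hsin x ^+ 2 = 1.
Proof.
move=> /andP[x0 x1]; have n0 : 1 - x ^+ 2 != 0 by rewrite gt_eqF//; nra.
by rewrite /hcos /hsin; field.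
Qed.

Lemma hcos_gt1 x : 0 < x < 1 -> 1 < hcos x.
Proof.
move=> x01; have := hcos2_hsin2 x01.
by have := hcos_gt0 x01; have := hsin_gt0 x01; nra.
Qed.

Lemma coshlen_gt1 x y I : 0 < x < 1 -> 0 < y < 1 -> 0 <= I -> 1 < coshlen x y I.
Proof.
move=> x01 y01 I0; apply: ltr_wpDr.
  exact: mulr_ge0 (mulr_ge0 I0 (ltW (hsin_gt0 x01))) (ltW (hsin_gt0 y01)).
exact: mulr_egt1 (hcos_gt1 x01) (hcos_gt1 y01).
Qed.

(** As [d ln (tanh (r / 2)) = dr / sinh r], speed [v] in the coordinate [u] is speed [v * sinh r] in
    [r]. *)
Lemma is_derive_hcos_hsin f t v : 0 < f t < 1 -> is_derive t 1 f (v * f t) ->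
  is_derive t 1 (fun z => hcos (f z)) (v * hsin (f t) ^+ 2) /\
  is_derive t 1 (fun z => hsin (f z)) (v * hcos (f t) * hsin (f t)).
Proof.
move=> /andP[f0 f1] hf; have n0 : 1 - f t ^+ 2 != 0 by rewrite gt_eqF//; nra.
have hff := is_derive_mul hf hf.
have h1 : is_derive t 1 (fun z => 1 - f z * f z) (0 - (f t * (v * f t) + f t * (v * f t))).
  exact: is_derive_sub (is_derive_const t 1) hff.
have hV := @is_deriveV _ (fun z => 1 - f z * f z) t _ 1 n0 h1.
split.
  have := is_derive_mul (is_derive_add (is_derive_const t 1) hff) hV.
  by move=> H; apply: is_derive_eq H _; rewrite /hcos /hsin /GRing.scale/=; field.
have := is_derive_mul (is_derive_scale 2 hf) hV.
by move=> H; apply: is_derive_eq H _; rewrite /hcos /hsin /GRing.scale/=; field.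
Qed.

Lemma is_derive_coshlen f g t v w I : 0 < f t < 1 -> 0 < g t < 1 ->
  is_derive t 1 f (v * f t) -> is_derive t 1 g (w * g t) ->
  is_derive t 1 (fun z => coshlen (f z) (g z) I)
    ((coshlen (f t) (g t) I * hcos (f t) - hcos (g t)) * v +
     (coshlen (f t) (g t) I * hcos (g t) - hcos (f t)) * w).
Proof.
move=> f01 g01 hf hg.
have [fc fs] := is_derive_hcos_hsin f01 hf; have [gc gs] := is_derive_hcos_hsin g01 hg.
have := is_derive_add (is_derive_mul fc gc) (is_derive_mul (is_derive_scale I fs) gs).
move=> H; apply: is_derive_eq H _.
have kf := hcos2_hsin2 f01; have kg := hcos2_hsin2 g01.
set c := coshlen _ _ _.
(* Homogenizing by [hcos ^+ 2 - hsin ^+ 2 = 1] leaves a polynomial identity. *)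
have -> : c * hcos (f t) - hcos (g t) =
    c * hcos (f t) - hcos (g t) * (hcos (f t) ^+ 2 - hsin (f t) ^+ 2).
  by rewrite kf mulr1.
have -> : c * hcos (g t) - hcos (f t) =
    c * hcos (g t) - hcos (f t) * (hcos (g t) ^+ 2 - hsin (g t) ^+ 2).
  by rewrite kg mulr1.
by rewrite /c /coshlen; ring.
Qed.

Lemma hyp_triangle_monotone (x1 x2 x3 y1 y2 y3 I1 I2 I3 : R) :
  0 < x1 < 1 -> 0 < x2 < 1 -> 0 < x3 < 1 ->
  0 < y1 < 1 -> 0 < y2 < 1 -> 0 < y3 < 1 ->
  0 <= I1 -> 0 <= I2 -> 0 <= I3 ->
  let v1 := ln y1 - ln x1 in let v2 := ln y2 - ln x2 in let v3 := ln y3 - ln x3 in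
  let C1 := coshlen x2 x3 I1 in let C2 := coshlen x1 x3 I2 in
  let C3 := coshlen x1 x2 I3 in
  let D1 := coshlen y2 y3 I1 in let D2 := coshlen y1 y3 I2 in
  let D3 := coshlen y1 y2 I3 in
  0 < gram C1 C2 C3 -> [|| v1 != 0, v2 != 0 | v3 != 0] ->
  v1 * angle (D2 * D3 - D1) ((D2 ^+ 2 - 1) * (D3 ^+ 2 - 1)) +
  v2 * angle (D1 * D3 - D2) ((D1 ^+ 2 - 1) * (D3 ^+ 2 - 1)) +
  v3 * angle (D1 * D2 - D3) ((D1 ^+ 2 - 1) * (D2 ^+ 2 - 1)) <
  v1 * angle (C2 * C3 - C1) ((C2 ^+ 2 - 1) * (C3 ^+ 2 - 1)) +
  v2 * angle (C1 * C3 - C2) ((C1 ^+ 2 - 1) * (C3 ^+ 2 - 1)) +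
  v3 * angle (C1 * C2 - C3) ((C1 ^+ 2 - 1) * (C2 ^+ 2 - 1)).
Proof.
move=> x1_01 x2_01 x3_01 y1_01 y2_01 y3_01 I1_ge0 I2_ge0 I3_ge0.
move=> v1 v2 v3 C1 C2 C3 D1 D2 D3 G_gt0 v_neq0.
pose X1 t := geodesic x1 v1 t; pose X2 t := geodesic x2 v2 t; pose X3 t := geodesic x3 v3 t.
pose l1 t := coshlen (X2 t) (X3 t) I1.
pose l2 t := coshlen (X1 t) (X3 t) I2.
pose l3 t := coshlen (X1 t) (X2 t) I3.
have H := @angle_sum_decreases _
  (fun t => l2 t * l3 t - l1 t) (fun t => l1 t * l3 t - l2 t) (fun t => l1 t * l2 t - l3 t)
  (fun t => (l2 t * l2 t - 1) * (l3 t * l3 t - 1))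
  (fun t => (l1 t * l1 t - 1) * (l3 t * l3 t - 1))
  (fun t => (l1 t * l1 t - 1) * (l2 t * l2 t - 1))
  (fun t => gram (l1 t) (l2 t) (l3 t)) v1 v2 v3.
have l10 : l1 0 = C1 by rewrite /l1 /X2 /X3 !geodesic0.
have l20 : l2 0 = C2 by rewrite /l2 /X1 /X3 !geodesic0.
have l30 : l3 0 = C3 by rewrite /l3 /X1 /X2 !geodesic0.
have e1 x y : 0 < x < 1 -> 0 < y < 1 -> geodesic x (ln y - ln x) 1 = y.
  by move=> /andP[x0 _] /andP[y0 _]; exact: geodesic1.
have l11 : l1 1 = D1 by rewrite /l1 /X2 /X3 !e1.
have l21 : l2 1 = D2 by rewrite /l2 /X1 /X3 !e1.
have l31 : l3 1 = D3 by rewrite /l3 /X1 /X2 !e1.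
rewrite l10 l20 l30 l11 l21 l31 in H; apply: H => // t t01.
have e01 x y : 0 < x < 1 -> 0 < y < 1 -> 0 < geodesic x (ln y - ln x) t < 1.
  by move=> x01 y01; rewrite geodesic_lt1// andbT geodesic_gt0//; case/andP: x01.
have X1_01 : 0 < X1 t < 1 by exact: e01.
have X2_01 : 0 < X2 t < 1 by exact: e01.
have X3_01 : 0 < X3 t < 1 by exact: e01.
have s_gt0 (x : R) : 1 < x -> 0 < x ^+ 2 - 1 by move=> ?; nra.
have l1_gt0 : 0 < l1 t ^+ 2 - 1 by apply: s_gt0; exact: coshlen_gt1.
have l2_gt0 : 0 < l2 t ^+ 2 - 1 by apply: s_gt0; exact: coshlen_gt1.
have l3_gt0 : 0 < l3 t ^+ 2 - 1 by apply: s_gt0; exact: coshlen_gt1.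
have d1 := is_derive_coshlen I1 X2_01 X3_01
  (is_derive_geodesic x2 v2 t) (is_derive_geodesic x3 v3 t).
have d2 := is_derive_coshlen I2 X1_01 X3_01
  (is_derive_geodesic x1 v1 t) (is_derive_geodesic x3 v3 t).
have d3 := is_derive_coshlen I3 X1_01 X2_01
  (is_derive_geodesic x1 v1 t) (is_derive_geodesic x2 v2 t).
rewrite -/(X1 t) -/(X2 t) -/(X3 t) -/(l1 t) in d1 d2 d3.
rewrite -/(l1 t) in d1; rewrite -/(l2 t) in d2; rewrite -/(l3 t) in d3.
have dS (l : R -> R) (dl : R) : is_derive t 1 l dl ->
    is_derive t 1 (fun z => l z * l z - 1) (l t * dl + l t * dl - 0).
  by move=> hl; exact: is_derive_sub (is_derive_mul hl hl) (is_derive_const t 1).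
do 6!eexists; split; first split.
- exact: is_derive_sub (is_derive_mul d2 d3) d1.
- exact: is_derive_sub (is_derive_mul d1 d3) d2.
- exact: is_derive_sub (is_derive_mul d1 d2) d3.
- split.
  + exact: is_derive_mul (dS _ _ d2) (dS _ _ d3).
  + exact: is_derive_mul (dS _ _ d1) (dS _ _ d3).
  + exact: is_derive_mul (dS _ _ d1) (dS _ _ d2).
- by split; apply: mulr_gt0.
- by split; rewrite /gram; ring.
(* Here [dq / (2 * q)] is [C2 * dC2 / (C2 ^+ 2 - 1) + C3 * dC3 / (C3 ^+ 2 - 1)], which gives
   [hyp_dangle]. *)
- move=> Gt; have := hyp_form_gt0 (hcos_gt0 X1_01) (hcos_gt0 X2_01) (hcos_gt0 X3_01)
    (hsin_gt0 X1_01) (hsin_gt0 X2_01) (hsin_gt0 X3_01)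
    (hcos2_hsin2 X1_01) (hcos2_hsin2 X2_01) (hcos2_hsin2 X3_01)
    I1_ge0 I2_ge0 I3_ge0 Gt v_neq0.
  rewrite /= -/(coshlen (X2 t) (X3 t) I1) -/(coshlen (X1 t) (X3 t) I2).
  rewrite -/(coshlen (X1 t) (X2 t) I3).
  rewrite -/(l1 t) -/(l2 t) -/(l3 t) /hyp_dangle.
  congr (0 < _); field.
  by rewrite !gt_eqF.
Qed.

End hyperbolic_paths.

(** * Nondegenerate triangles, and the coordinate [tanh (r / 2)] *)

Section triangles.
Context {R : realType}.
Implicit Types a b c x y r C L : R.

Lemma heron_gt0 L1 L2 L3 : 0 < L1 -> 0 < L2 -> 0 < L3 ->
  Num.sqrt L1 < Num.sqrt L2 + Num.sqrt L3 ->
  Num.sqrt L2 < Num.sqrt L1 + Num.sqrt L3 ->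
  Num.sqrt L3 < Num.sqrt L1 + Num.sqrt L2 -> 0 < heron L1 L2 L3.
Proof.
move=> L1_gt0 L2_gt0 L3_gt0.
have square (L : R) : 0 < L -> exists2 a, 0 < a & L = a ^+ 2.
  by move=> L0; exists (Num.sqrt L); rewrite ?sqrtr_gt0// sqr_sqrtr// ltW.
have [a a0 ->] := square _ L1_gt0; have [b b0 ->] := square _ L2_gt0.
have [c c0 ->] := square _ L3_gt0.
rewrite !sqrtr_sqr !gtr0_norm// => t1 t2 t3.
have -> : heron (a ^+ 2) (b ^+ 2) (c ^+ 2) =
    (a + b + c) * (b + c - a) * (a + c - b) * (a + b - c) by rewrite /heron; ring.
by rewrite !mulr_gt0 ?subr_gt0 ?addr_gt0.
Qed.

Lemma euc_inner_angleE L1 L2 L3 : 0 < L1 -> 0 < L2 -> 0 < L3 -> 0 < heron L1 L2 L3 ->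
  inner_angle Euclidean (Num.sqrt L1) (Num.sqrt L2) (Num.sqrt L3) =
  angle (L2 + L3 - L1) (4 * L2 * L3).
Proof.
move=> L1_gt0 L2_gt0 L3_gt0 G; rewrite angleE; last by rewrite -subr_gt0.
rewrite /= !sqr_sqrtr ?ltW//; congr (acos (_ / _)).
have -> : 4 * L2 * L3 = (2 * Num.sqrt L2 * Num.sqrt L3) ^+ 2.
  by rewrite !exprMn !sqr_sqrtr ?ltW//; ring.
by rewrite sqrtr_sqr ger0_norm// !mulr_ge0// sqrtr_ge0.
Qed.

Lemma inner_angleC g a b c : inner_angle g a b c = inner_angle g a c b.
Proof.
case: g => /=; first by rewrite (addrC (b ^+ 2)) (mulrAC 2 b).
by rewrite (mulrC (cosh b)) (mulrC (sinh b)).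
Qed.

Lemma coshD x y : cosh (x + y) = cosh x * cosh y + sinh x * sinh y.
Proof. by rewrite /cosh /sinh opprD !expRD; field. Qed.

Lemma coshB x y : cosh (x - y) = cosh x * cosh y - sinh x * sinh y.
Proof. by rewrite /cosh /sinh opprB !expRD; field. Qed.

Lemma sinh_gt0 x : 0 < x -> 0 < sinh x.
Proof. by move=> x0; rewrite /sinh divr_gt0// subr_gt0 ltr_expR; lra. Qed.

Lemma ltr_cosh x y : `|x| < y -> cosh x < cosh y.
Proof.
rewrite ltr_norml => /andP[xy yx].
rewrite -subr_gt0; have -> : cosh y - cosh x = 2 * sinh ((y + x) / 2) * sinh ((y - x) / 2).
  have -> : cosh y = cosh ((y + x) / 2 + (y - x) / 2) by congr cosh; field.
  have -> : cosh x = cosh ((y + x) / 2 - (y - x) / 2) by congr cosh; field.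
  by rewrite coshD coshB; ring.
have p : 0 < (y + x) / 2 by lra.
have m : 0 < (y - x) / 2 by lra.
exact: mulr_gt0 (mulr_gt0 (ltr0Sn _ 1) (sinh_gt0 p)) (sinh_gt0 m).
Qed.

(** The triangle inequalities place [cosh a] strictly between [cosh (b - c)] and [cosh (b + c)], and
    [gram] is the product of the two gaps. *)
Lemma gram_gt0 C1 C2 C3 : 1 < C1 -> 1 < C2 -> 1 < C3 ->
  arcosh C1 < arcosh C2 + arcosh C3 -> arcosh C2 < arcosh C1 + arcosh C3 ->
  arcosh C3 < arcosh C1 + arcosh C2 -> 0 < gram C1 C2 C3.
Proof.
move=> C1_gt1 C2_gt1 C3_gt1 t1 t2 t3.
have up : cosh (arcosh C1) < cosh (arcosh C2 + arcosh C3).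
  by apply: ltr_cosh; rewrite ger0_norm// arcosh_ge0// ltW.
have lo : cosh (arcosh C2 - arcosh C3) < cosh (arcosh C1).
  by apply: ltr_cosh; rewrite ltr_norml; apply/andP; split; lra.
move: up lo; rewrite coshD coshB !arcoshK ?ltW// !sinh_arcosh ?ltW//.
set s := Num.sqrt _; set u := Num.sqrt _ => up lo.
have s2 : s ^+ 2 = C2 ^+ 2 - 1 by rewrite sqr_sqrtr//; nra.
have u2 : u ^+ 2 = C3 ^+ 2 - 1 by rewrite sqr_sqrtr//; nra.
have -> : gram C1 C2 C3 = (C2 * C3 + s * u - C1) * (C1 - (C2 * C3 - s * u)).
  have -> : (C2 * C3 + s * u - C1) * (C1 - (C2 * C3 - s * u)) =
    s ^+ 2 * u ^+ 2 - (C2 * C3 - C1) ^+ 2 by ring.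
  by rewrite s2 u2 /gram; ring.
by rewrite mulr_gt0// subr_gt0.
Qed.

Lemma hyp_inner_angleE C1 C2 C3 : 1 < C1 -> 1 < C2 -> 1 < C3 -> 0 < gram C1 C2 C3 ->
  inner_angle Hyperbolic (arcosh C1) (arcosh C2) (arcosh C3) =
  angle (C2 * C3 - C1) ((C2 ^+ 2 - 1) * (C3 ^+ 2 - 1)).
Proof.
move=> C1_gt1 C2_gt1 C3_gt1 G.
have S2 : 0 <= C2 ^+ 2 - 1 by nra.
rewrite angleE; last first.
  rewrite -subr_gt0; move: G; congr (0 < _); rewrite /gram; ring.
by rewrite /= !arcoshK ?ltW// !sinh_arcosh ?ltW// sqrtrM.
Qed.

Lemma cosh_gt0 x : 0 < cosh x.
Proof. by rewrite divr_gt0// addr_gt0// expR_gt0. Qed.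

Lemma hcos_tanh r : hcos (tanh (r / 2)) = cosh r.
Proof.
have -> : cosh r = cosh (r / 2 + r / 2) by congr cosh; field.
rewrite coshD /hcos /tanh; have := cosh2_sinh2 (r / 2); have := cosh_gt0 (r / 2).
move: (cosh _) (sinh _) => c s c0 k; have c_neq0 : c != 0 by rewrite gt_eqF.
have -> : 1 - (s / c) ^+ 2 = (c ^+ 2 - s ^+ 2) / c ^+ 2 by field.
by rewrite k; field.
Qed.

Lemma hsin_tanh r : hsin (tanh (r / 2)) = sinh r.
Proof.
have -> : sinh r = 2 * sinh (r / 2) * cosh (r / 2).
  have -> : sinh r = sinh (r / 2 + r / 2) by congr sinh; field.
  by rewrite /sinh /cosh opprD !expRD; field.
rewrite /hsin /tanh; have := cosh2_sinh2 (r / 2); have := cosh_gt0 (r / 2).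
move: (cosh _) (sinh _) => c s c0 k; have c_neq0 : c != 0 by rewrite gt_eqF.
have -> : 1 - (s / c) ^+ 2 = (c ^+ 2 - s ^+ 2) / c ^+ 2 by field.
by rewrite k; field.
Qed.

Lemma tanh_half_itv r : 0 < r -> 0 < tanh (r / 2) < 1.
Proof.
move=> r0; have s0 : 0 < sinh (r / 2) by rewrite sinh_gt0// divr_gt0.
rewrite divr_gt0 ?cosh_gt0//= ltr_pdivrMr ?cosh_gt0// mul1r.
rewrite /sinh /cosh ltr_pM2r ?invr_gt0// ltrD2l.
by have := expR_gt0 (- (r / 2)); lra.
Qed.

Lemma cosh_inj r r' : 0 < r -> 0 < r' -> cosh r = cosh r' -> r = r'.
Proof.
move=> r0 r'0 E; have [lt|lt|//] := ltgtP r r'.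
- by have := @ltr_cosh r r'; rewrite gtr0_norm// E ltxx => /(_ lt).
- by have := @ltr_cosh r' r; rewrite gtr0_norm// E ltxx => /(_ lt).
Qed.

(** Since [exp] is increasing, [y ^ alpha - x ^ alpha] has the sign of [alpha * (ln y - ln x)].
    Multiplication by [alpha ^+ 2] distributes one [alpha] to this difference and the other to
    [rho]. *)
Lemma powR_ln_monotone (alpha rho x y : R) : 0 < x -> 0 < y -> alpha * rho <= 0 ->
  rho * (y `^ alpha - x `^ alpha) * (ln y - ln x) <= 0 /\
  (alpha * rho < 0 -> ln y != ln x ->
   rho * (y `^ alpha - x `^ alpha) * (ln y - ln x) < 0).
Proof.
move=> x0 y0; rewrite /powR (gt_eqF x0) (gt_eqF y0).
move: (ln x) (ln y) => u v ar.
have [->|a0] := eqVneq alpha 0.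
  by rewrite !mul0r subrr mulr0 mul0r ltxx.
set P := expR _ - _.
have a2 : 0 < alpha ^+ 2 by rewrite exprn_even_gt0.
have E : alpha ^+ 2 * (rho * P * (v - u)) = (alpha * rho) * (P * (alpha * v - alpha * u)).
  by ring.
have mono : 0 <= P * (alpha * v - alpha * u) /\
    (v != u -> 0 < P * (alpha * v - alpha * u)).
  have [->|vu] := eqVneq v u; first by rewrite subrr mulr0.
  suff h : 0 < P * (alpha * v - alpha * u) by split=> //; exact: ltW.
  have : alpha * v != alpha * u by rewrite (inj_eq (mulfI a0)).
  rewrite neq_lt => /orP[lt|lt]; have := lt; rewrite -ltr_expR => lt'.
    by rewrite nmulr_rgt0 ?subr_lt0.
  by rewrite mulr_gt0 ?subr_gt0.
have [m1 m2] := mono.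
split; first by rewrite -(pmulr_rle0 _ a2) E mulr_le0_ge0.
by move=> ar' vu; rewrite -(pmulr_rlt0 _ a2) E nmulr_rlt0// m2.
Qed.

End triangles.

(** * Summation over the surface *)

Section face_sums.
Context {R : realFieldType} {N : nat} (F : {set {set 'I_N}}).
Hypothesis F_card : forall f, f \in F -> #|f| = 3%N.
Implicit Types (i j k : 'I_N) (t : 'I_N -> 'I_N -> 'I_N -> R).

Lemma set3_perm21 i j k : [set j; i; k] = [set i; j; k].
Proof. by rewrite [[set j; i]]finset.setUC. Qed.

Lemma set3_perm32 i j k : [set i; k; j] = [set i; j; k].
Proof. by rewrite finset.setUAC. Qed.

Lemma face_neq12 i j k : [set i; j; k] \in F -> i != j.
Proof.
move=> /F_card c; apply/eqP => ij; move: c; rewrite ij finset.setUid cards2.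
by case: (_ != _).
Qed.

Lemma face_neq23 i j k : [set i; j; k] \in F -> j != k.
Proof. by rewrite -set3_perm32 -set3_perm21 -set3_perm32 => /face_neq12; rewrite eq_sym. Qed.

Lemma sum_ordered_faces t : (forall i j k, t i j k = t i k j) ->
  \sum_(i < N) \sum_(j < N) \sum_(k < N | [set i; j; k] \in F) t i j k =
  2 * \sum_(i < N) \sum_(j < N) \sum_(k < N | (j < k)%N && ([set i; j; k] \in F)) t i j k.
Proof.
move=> tC; rewrite mulr_sumr; apply: eq_bigr => i _.
have -> : \sum_(j < N) \sum_(k < N | [set i; j; k] \in F) t i j k =
    \sum_(j < N) \sum_(k < N | (j < k)%N && ([set i; j; k] \in F)) t i j k +
    \sum_(j < N) \sum_(k < N | (k < j)%N && ([set i; j; k] \in F)) t i j k.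
  rewrite -big_split; apply: eq_bigr => j _ /=.
  rewrite (bigID (fun k : 'I_N => (j < k)%N)) /=; congr (_ + _).
    by apply: eq_bigl => k; rewrite andbC.
  apply: eq_bigl => k; rewrite andbC; case: (boolP (_ \in F)); rewrite ?andbF// !andbT.
  by move=> /face_neq23 jk; rewrite -leqNgt leq_eqVlt eq_sym (inj_eq val_inj) (negPf jk).
rewrite mulr_natl mulr2n; congr (_ + _).
rewrite (exchange_big_dep xpredT)//=; apply: eq_bigr => k _; apply: eq_big => j.
  by rewrite set3_perm32.
by move=> _; exact: tC.
Qed.

Definition face_total t i j k := t i j k + t j i k + t k i j.

Lemma face_totalB (v : 'I_N -> R) t t' i j k :
  face_total (fun i j k => v i * (t' i j k - t i j k)) i j k =
  (v i * t' i j k + v j * t' j i k + v k * t' k i j) -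
  (v i * t i j k + v j * t j i k + v k * t k i j).
Proof. by rewrite /face_total; ring. Qed.

Lemma face_totalB_eq0 (v : 'I_N -> R) t t' i j k :
  v i = 0 -> v j = 0 -> v k = 0 ->
  face_total (fun i j k => v i * (t' i j k - t i j k)) i j k = 0.
Proof. by rewrite /face_total => -> -> ->; rewrite !mul0r !addr0. Qed.

(** This passes from sums over corners to sums over faces: a face has six orderings, each
    contributing its three corners, whereas the condition [j < k] counts every corner once. *)
Lemma sum_face_total t : (forall i j k, t i j k = t i k j) ->
  \sum_(i < N) \sum_(j < N) \sum_(k < N | [set i; j; k] \in F) face_total t i j k =
  6 * \sum_(i < N) \sum_(j < N) \sum_(k < N | (j < k)%N && ([set i; j; k] \in F)) t i j k.
Proof.
move=> tC; rewrite [in RHS](_ : 6 = 3 * 2) -?mulrA -?sum_ordered_faces//; last by ring.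
set S := RHS.
have E1 : \sum_(i < N) \sum_(j < N) \sum_(k < N | [set i; j; k] \in F) t j i k =
    \sum_(i < N) \sum_(j < N) \sum_(k < N | [set i; j; k] \in F) t i j k.
  rewrite exchange_big; apply: eq_bigr => i _; apply: eq_bigr => j _.
  by apply: eq_bigl => k; rewrite set3_perm21.
have E2 : \sum_(i < N) \sum_(j < N) \sum_(k < N | [set i; j; k] \in F) t k i j =
    \sum_(i < N) \sum_(j < N) \sum_(k < N | [set i; j; k] \in F) t i j k.
  rewrite -E1; apply: eq_bigr => i _.
  rewrite (exchange_big_dep xpredT)//=; apply: eq_bigr => k _.
  by apply: eq_bigl => j; rewrite set3_perm32.
transitivity (\sum_(i < N) \sum_(j < N) \sum_(k < N | [set i; j; k] \in F) t i j k +
  \sum_(i < N) \sum_(j < N) \sum_(k < N | [set i; j; k] \in F) t j i k +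
  \sum_(i < N) \sum_(j < N) \sum_(k < N | [set i; j; k] \in F) t k i j).
  rewrite -!big_split; apply: eq_bigr => i _; rewrite -!big_split.
  by apply: eq_bigr => j _; rewrite -!big_split.
by rewrite E1 E2 /S; ring.
Qed.

Lemma sum_faces_le0 t : (forall i j k, t i j k = t i k j) ->
  (forall i j k, [set i; j; k] \in F -> face_total t i j k <= 0) ->
  \sum_(i < N) \sum_(j < N) \sum_(k < N | (j < k)%N && ([set i; j; k] \in F)) t i j k <= 0.
Proof.
move=> tC t_le0; rewrite -(pmulr_rle0 _ (_ : 0 < 6))// -sum_face_total//.
by do 2!(apply: sumr_le0 => ? _); apply: sumr_le0 => k; exact: t_le0.
Qed.

Lemma sum_faces_lt0 t i j k : (forall i j k, t i j k = t i k j) ->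
  (forall i j k, [set i; j; k] \in F -> face_total t i j k <= 0) ->
  [set i; j; k] \in F -> face_total t i j k < 0 ->
  \sum_(i < N) \sum_(j < N) \sum_(k < N | (j < k)%N && ([set i; j; k] \in F)) t i j k < 0.
Proof.
move=> tC t_le0 ijk lt0; rewrite -(pmulr_rlt0 _ (_ : 0 < 6))// -sum_face_total//.
have fibre_le0 i' j' (P : pred 'I_N) :
    \sum_(k' < N | ([set i'; j'; k'] \in F) && P k') face_total t i' j' k' <= 0.
  by apply: sumr_le0 => k' /andP[? _]; exact: t_le0.
have fibres_le0 i' (P : pred 'I_N) :
    \sum_(j' < N | P j') \sum_(k' < N | [set i'; j'; k'] \in F) face_total t i' j' k' <= 0.
  by apply: sumr_le0 => j' _; apply: sumr_le0 => k'; exact: t_le0.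
have all_le0 (P : pred 'I_N) : \sum_(i' < N | P i') \sum_(j' < N)
    \sum_(k' < N | [set i'; j'; k'] \in F) face_total t i' j' k' <= 0.
  by apply: sumr_le0 => i' _; exact: fibres_le0.
rewrite (bigD1 i)//= (bigD1 j)//= (bigD1 k)//=.
have := fibre_le0 i j (fun k' => k' != k).
have := fibres_le0 i (fun j' => j' != j).
by have := all_le0 (fun i' => i' != i); lra.
Qed.

End face_sums.

(** * Comparing curvatures by vertices and by faces *)

Section surfaces.
Context {R : realType} {N : nat} (T : triangulated_surface N).
Implicit Types (i j k : 'I_N) (I : {set 'I_N} -> R) (r : 'I_N -> R).

Lemma edge_in_face i j : [set i; j] \in edges T -> exists k, [set i; j; k] \in faces T.
Proof.
move=> /edgeP[ij [f fF sub]].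
have : #|f :\: [set i; j]| == 1%N.
  by rewrite cardsD (face_card fF) (finset.setIidPr sub) ij.
move=> /cards1P[k fk]; exists k; rewrite -fk.
by rewrite -{1}(finset.setIidPr sub) finset.setID.
Qed.

Lemma face_edge i j k : [set i; j; k] \in faces T -> [set i; j] \in edges T.
Proof.
move=> h; apply/edgeP; split; last by exists [set i; j; k] => //; exact: finset.subsetUl.
by rewrite cards2 (face_neq12 (@face_card _ T) h).
Qed.

Lemma vertex_face i : exists j k, [set i; j; k] \in faces T.
Proof.
have [f fF fi] := vertex_in_face T i.
have /eqP/cards2P[j [k [_ E]]] : #|f :\ i| = 2%N.
  by have := cardsD1 i f; rewrite (face_card fF) fi => -[].
by exists j, k; rewrite -finset.setUA -E finset.setD1K.
Qed.

Lemma const_on_surface (v : 'I_N -> R) :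
  (forall i j k, [set i; j; k] \in faces T -> v i = v j) -> forall i j, v i = v j.
Proof.
move=> h i j; have /connectP[p] := surface_connected T i j.
elim: p i => [|x p IH] i /=; first by move=> _ ->.
by move=> /andP[/edge_in_face[k /h ->]] ? ?; exact: IH.
Qed.

Section geometry.
Variable g : geometry.

Lemma edge_lengthC I r i j : edge_length g I r i j = edge_length g I r j i.
Proof.
rewrite /edge_length finset.setUC; case: g; first by congr Num.sqrt; ring.
by congr arcosh; ring.
Qed.

Lemma face_angleC I r i j k : face_angle g I r i j k = face_angle g I r i k j.
Proof. by rewrite /face_angle [edge_length g I r j k]edge_lengthC inner_angleC. Qed.

(** The quantity whose logarithm is [u_i]; in both geometries the [alpha]-curvature is the Gauss
    curvature divided by its power [alpha]. *)
Definition coord r i : R :=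
  match g with Euclidean => r i | Hyperbolic => tanh (r i / 2) end.

Lemma coord_gt0 r i : 0 < r i -> 0 < coord r i.
Proof. by rewrite /coord; case: g => // /tanh_half_itv/andP[]. Qed.

(** The sum of [v i * (K' i - K i)] has nonpositive terms when taken by vertices, by
    [powR_ln_monotone], and is minus a sum of nonpositive terms when taken by faces. Hence all terms
    vanish on both sides, and [v i = 0] wherever the vertex term would otherwise be strictly
    negative. *)
Lemma face_totals_ge0 alpha I (Rbar : 'I_N -> R) r r' :
  (forall i, 0 < r i) -> (forall i, 0 < r' i) ->
  (forall i, alpha_curvature g T alpha I r i = Rbar i) ->
  (forall i, alpha_curvature g T alpha I r' i = Rbar i) ->
  (forall i, alpha * Rbar i <= 0) ->
  let v i := ln (coord r' i) - ln (coord r i) in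
  let t i j k := v i * (face_angle g I r' i j k - face_angle g I r i j k) in
  (forall i j k, [set i; j; k] \in faces T -> face_total t i j k <= 0) ->
  (forall i j k, [set i; j; k] \in faces T -> 0 <= face_total t i j k) /\
  (forall i, alpha * Rbar i <> 0 -> v i = 0).
Proof.
move=> r_gt0 r'_gt0 hr hr' aR v t t_le0.
have tC i j k : t i j k = t i k j by rewrite /t ![face_angle _ _ _ _ k _]face_angleC.
have curvE s i : (forall i, 0 < s i) -> alpha_curvature g T alpha I s i = Rbar i ->
    gauss_curvature g T I s i = Rbar i * coord s i `^ alpha.
  move=> s_gt0 <-; have p0 := powR_gt0 alpha (coord_gt0 (s_gt0 i)).
  by move: p0; rewrite /alpha_curvature /coord; case: g => p0; rewrite divfK// gt_eqF.
pose u i := v i * (gauss_curvature g T I r' i - gauss_curvature g T I r i).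
have uE i : u i = Rbar i * (coord r' i `^ alpha - coord r i `^ alpha) *
    (ln (coord r' i) - ln (coord r i)).
  by rewrite /u !curvE// -mulrBr /v mulrC.
have mono i := powR_ln_monotone (coord_gt0 (r_gt0 i)) (coord_gt0 (r'_gt0 i)) (aR i).
have u_le0 i : u i <= 0 by rewrite uE; case: (mono i).
pose A s i := \sum_(j < N) \sum_(k < N | (j < k)%N && ([set i; j; k] \in faces T))
  face_angle g I s i j k.
have gaussE s i : gauss_curvature g T I s i = 2 * pi - A s i by [].
have sumE : \sum_(i < N) u i = - \sum_(i < N) \sum_(j < N)
    \sum_(k < N | (j < k)%N && ([set i; j; k] \in faces T)) t i j k.
  rewrite -sumrN; apply: eq_bigr => i _.
  transitivity (- (v i * (A r' i - A r i))).
    rewrite /u !gaussE.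
    by move: (A r' i) (A r i) (v i) => *; ring.
  congr (- _); rewrite /A -sumrB mulr_sumr; apply: eq_bigr => j _.
  by rewrite -sumrB mulr_sumr.
have cardF := @face_card _ T.
have sum_u_le0 (P : pred 'I_N) : \sum_(i < N | P i) u i <= 0.
  by apply: sumr_le0 => i _; exact: u_le0.
split=> [i j k ijk|i /eqP aRi].
  rewrite leNgt; apply/negP => lt0.
  have := sum_faces_lt0 cardF tC t_le0 ijk lt0.
  by have := sum_u_le0 xpredT; rewrite sumE; lra.
apply/eqP; apply/negP => /negP vi.
have ui : u i < 0.
  by rewrite uE; apply: (mono i).2; rewrite ?lt_neqAle ?aRi ?aR// -subr_eq0.
have := sum_faces_le0 cardF tC t_le0.
have := sum_u_le0 (fun i' => i' != i).
by move: sumE; rewrite (bigD1 i)//=; lra.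
Qed.

End geometry.
End surfaces.

(** * Uniqueness of packing metrics *)

Section rigidity.
Context {R : realType} {N : nat} (T : triangulated_surface N).
Variable I : {set 'I_N} -> R.
Hypothesis I_ge0 : nonneg_weight T I.
Implicit Types (i j k : 'I_N) (r : 'I_N -> R).

Lemma face_weights_ge0 i j k : [set i; j; k] \in faces T ->
  [/\ 0 <= I [set j; k], 0 <= I [set i; k] & 0 <= I [set i; j]].
Proof.
move=> h; split; apply: I_ge0; last exact: face_edge h.
  by apply: (@face_edge _ _ j k i); rewrite set3_perm32 set3_perm21.
by apply: (@face_edge _ _ i k j); rewrite set3_perm32.
Qed.

Lemma face_sides g r i j k : packing_metric g T I r -> [set i; j; k] \in faces T ->
  let a := edge_length g I r j k in let b := edge_length g I r i k in
  let c := edge_length g I r i j in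
  [/\ [/\ a < b + c, b < a + c & c < a + b],
      face_angle g I r i j k = inner_angle g a b c,
      face_angle g I r j i k = inner_angle g b a c &
      face_angle g I r k i j = inner_angle g c a b].
Proof.
move=> [_ tri] h a b c.
have C x y : edge_length g I r x y = edge_length g I r y x by exact: edge_lengthC.
split.
- split.
  + by rewrite addrC /c C; apply: tri; rewrite set3_perm32 set3_perm21.
  + by rewrite addrC; apply: tri; rewrite set3_perm32.
  + by rewrite addrC /a C; exact: tri.
- by rewrite /face_angle inner_angleC.
- by rewrite /face_angle inner_angleC (C j i).
- by rewrite /face_angle inner_angleC (C k i) (C k j).
Qed.

Lemma euc_face r i j k :
  packing_metric Euclidean T I r -> [set i; j; k] \in faces T ->
  let L1 := sqlen (r j) (r k) (I [set j; k]) in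
  let L2 := sqlen (r i) (r k) (I [set i; k]) in
  let L3 := sqlen (r i) (r j) (I [set i; j]) in
  [/\ 0 < heron L1 L2 L3,
      face_angle Euclidean I r i j k = angle (L2 + L3 - L1) (4 * L2 * L3),
      face_angle Euclidean I r j i k = angle (L1 + L3 - L2) (4 * L1 * L3) &
      face_angle Euclidean I r k i j = angle (L1 + L2 - L3) (4 * L1 * L2)].
Proof.
move=> pr h L1 L2 L3; have [Ijk Iik Iij] := face_weights_ge0 h.
have [r_gt0 _] := pr.
have L1_gt0 : 0 < L1 by exact: sqlen_gt0.
have L2_gt0 : 0 < L2 by exact: sqlen_gt0.
have L3_gt0 : 0 < L3 by exact: sqlen_gt0.
have [[t1 t2 t3] -> -> ->] := face_sides pr h.
have G : 0 < heron L1 L2 L3 by exact: heron_gt0 t1 t2 t3.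
have G2 : 0 < heron L2 L1 L3 by move: G; congr (0 < _); rewrite /heron; ring.
have G3 : 0 < heron L3 L1 L2 by move: G; congr (0 < _); rewrite /heron; ring.
split=> //.
- exact: (euc_inner_angleE L1_gt0 L2_gt0 L3_gt0 G).
- exact: (euc_inner_angleE L2_gt0 L1_gt0 L3_gt0 G2).
- exact: (euc_inner_angleE L3_gt0 L1_gt0 L2_gt0 G3).
Qed.

Lemma edge_length_hyp r i j :
  edge_length Hyperbolic I r i j =
  arcosh (coshlen (tanh (r i / 2)) (tanh (r j / 2)) (I [set i; j])).
Proof. by rewrite /coshlen !hcos_tanh !hsin_tanh. Qed.

Lemma hyp_face r i j k :
  packing_metric Hyperbolic T I r -> [set i; j; k] \in faces T ->
  let x i := tanh (r i / 2) in
  let C1 := coshlen (x j) (x k) (I [set j; k]) in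
  let C2 := coshlen (x i) (x k) (I [set i; k]) in
  let C3 := coshlen (x i) (x j) (I [set i; j]) in
  [/\ 0 < gram C1 C2 C3,
      face_angle Hyperbolic I r i j k =
        angle (C2 * C3 - C1) ((C2 ^+ 2 - 1) * (C3 ^+ 2 - 1)),
      face_angle Hyperbolic I r j i k =
        angle (C1 * C3 - C2) ((C1 ^+ 2 - 1) * (C3 ^+ 2 - 1)) &
      face_angle Hyperbolic I r k i j =
        angle (C1 * C2 - C3) ((C1 ^+ 2 - 1) * (C2 ^+ 2 - 1))].
Proof.
move=> pr h x C1 C2 C3; have [Ijk Iik Iij] := face_weights_ge0 h.
have [r_gt0 _] := pr.
have x01 l : 0 < x l < 1 by exact: tanh_half_itv.
have C1_gt1 : 1 < C1 by exact: coshlen_gt1.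
have C2_gt1 : 1 < C2 by exact: coshlen_gt1.
have C3_gt1 : 1 < C3 by exact: coshlen_gt1.
have [[t1 t2 t3] -> -> ->] := face_sides pr h.
rewrite !edge_length_hyp in t1 t2 t3 *.
have G : 0 < gram C1 C2 C3 by exact: gram_gt0 t1 t2 t3.
have G2 : 0 < gram C2 C1 C3 by move: G; congr (0 < _); rewrite /gram; ring.
have G3 : 0 < gram C3 C1 C2 by move: G; congr (0 < _); rewrite /gram; ring.
split=> //.
- exact: (hyp_inner_angleE C1_gt1 C2_gt1 C3_gt1 G).
- exact: (hyp_inner_angleE C2_gt1 C1_gt1 C3_gt1 G2).
- exact: (hyp_inner_angleE C3_gt1 C1_gt1 C2_gt1 G3).
Qed.

Lemma euc_face_total r r' i j k :
  packing_metric Euclidean T I r -> packing_metric Euclidean T I r' ->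
  [set i; j; k] \in faces T ->
  let v i := ln (r' i) - ln (r i) in
  let t i j k := v i *
    (face_angle Euclidean I r' i j k - face_angle Euclidean I r i j k) in
  face_total t i j k <= 0 /\
  ((v i != v j) || (v i != v k) -> face_total t i j k < 0).
Proof.
move=> pr pr' h v t; have [Ijk Iik Iij] := face_weights_ge0 h.
have [r_gt0 _] := pr; have [r'_gt0 _] := pr'.
have [G E1 E2 E3] := euc_face pr h; have [_ E1' E2' E3'] := euc_face pr' h.
have lt0 : (v i != v j) || (v i != v k) -> face_total t i j k < 0.
  move=> vne; have := euc_triangle_monotone (r_gt0 i) (r_gt0 j) (r_gt0 k)
    (r'_gt0 i) (r'_gt0 j) (r'_gt0 k) Ijk Iik Iij G vne.
  rewrite -E1 -E2 -E3 -E1' -E2' -E3' -subr_lt0.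
  by rewrite -(face_totalB v (face_angle Euclidean I r) (face_angle Euclidean I r')).
split=> //; have [vne|] := boolP ((v i != v j) || (v i != v k)); first by rewrite ltW// lt0.
(* When [v] is constant on the face, the two triangles differ by a dilation of ratio [expR (v i)];
   their angles agree and the total is zero. *)
rewrite negb_or !negbK => /andP[/eqP vij /eqP vik].
have r'E l : v l = v i -> r' l = expR (v i) * r l.
  move=> <-; rewrite /v expRD expRN !lnK ?posrE//.
  by rewrite -mulrA mulVf ?mulr1// gt_eqF.
have sqlenE (e x y J : R) : sqlen (e * x) (e * y) J = e ^+ 2 * sqlen x y J.
  by rewrite /sqlen; ring.
have angleE (e p q : R) : 0 < e -> angle (e * p) (e ^+ 2 * q) = angle p q.
  move=> e0; rewrite /angle sqrtrM ?sqr_ge0// sqrtr_sqr gtr0_norm// invfM mulrACA.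
  by rewrite divff ?mul1r// gt_eqF.
move: E1' E2' E3'; rewrite (r'E i)// (r'E j)// (r'E k)// !sqlenE.
move: (expR_gt0 (v i)) (sqlen _ _ _) (sqlen _ _ _) (sqlen _ _ _) E1 E2 E3.
move: (expR (v i)) => e e0 L1 L2 L3 E1 E2 E3.
have e2 : 0 < e ^+ 2 by rewrite exprn_gt0.
have comb (p q s : R) : e ^+ 2 * p + e ^+ 2 * q - e ^+ 2 * s = e ^+ 2 * (p + q - s) by ring.
have prod (p q : R) : 4 * (e ^+ 2 * p) * (e ^+ 2 * q) = (e ^+ 2) ^+ 2 * (4 * p * q) by ring.
rewrite !comb !prod !angleE// => E1' E2' E3'.
by rewrite /face_total /t E1 E2 E3 E1' E2' E3' !subrr !mulr0 !addr0.
Qed.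

Lemma hyp_face_total r r' i j k :
  packing_metric Hyperbolic T I r -> packing_metric Hyperbolic T I r' ->
  [set i; j; k] \in faces T ->
  let v i := ln (tanh (r' i / 2)) - ln (tanh (r i / 2)) in
  let t i j k := v i *
    (face_angle Hyperbolic I r' i j k - face_angle Hyperbolic I r i j k) in
  face_total t i j k <= 0 /\ (v i != 0 -> face_total t i j k < 0).
Proof.
move=> pr pr' h v t; have [Ijk Iik Iij] := face_weights_ge0 h.
have [r_gt0 _] := pr; have [r'_gt0 _] := pr'.
have [G E1 E2 E3] := hyp_face pr h; have [_ E1' E2' E3'] := hyp_face pr' h.
have x01 l : 0 < tanh (r l / 2) < 1 by exact: tanh_half_itv.
have y01 l : 0 < tanh (r' l / 2) < 1 by exact: tanh_half_itv.
have lt0 : [|| v i != 0, v j != 0 | v k != 0] -> face_total t i j k < 0.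
  move=> vne; have := hyp_triangle_monotone (x01 i) (x01 j) (x01 k)
    (y01 i) (y01 j) (y01 k) Ijk Iik Iij G vne.
  rewrite -E1 -E2 -E3 -E1' -E2' -E3' -subr_lt0.
  by rewrite -(face_totalB v (face_angle Hyperbolic I r) (face_angle Hyperbolic I r')).
split=> [|vi]; last by rewrite lt0// vi.
have [vne|] := boolP [|| v i != 0, v j != 0 | v k != 0]; first by rewrite ltW// lt0.
rewrite !negb_or !negbK => /and3P[/eqP vi /eqP vj /eqP vk].
by rewrite (face_totalB_eq0 (face_angle Hyperbolic I r) (face_angle Hyperbolic I r') vi vj vk).
Qed.

(** A face on which [v] is not constant would have a negative total, so connectedness makes [v]
    constant on the surface and the metrics are proportional. A vertex where [alpha * Rbar] is
    nonzero forces this constant to be [0]. *)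
Lemma euc_rigidity alpha (Rbar : 'I_N -> R) r r' :
  (forall i, alpha * Rbar i <= 0) ->
  packing_metric Euclidean T I r -> packing_metric Euclidean T I r' ->
  (forall i, alpha_curvature Euclidean T alpha I r i = Rbar i) ->
  (forall i, alpha_curvature Euclidean T alpha I r' i = Rbar i) ->
  exists2 c : R, 0 < c & (forall i, r' i = c * r i) /\
    ((exists i, alpha * Rbar i <> 0) -> c = 1).
Proof.
move=> aR pr pr' hr hr'; have [r_gt0 _] := pr; have [r'_gt0 _] := pr'.
pose v i := ln (r' i) - ln (r i).
have [ge0 v0] := face_totals_ge0 r_gt0 r'_gt0 hr hr' aR
  (fun i j k h => (euc_face_total pr pr' h).1).
have vC : forall i j, v i = v j.
  apply: (const_on_surface (T := T)) => i j k h; apply/eqP; apply/negP => /negP vij.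
  have := (euc_face_total pr pr' h).2; rewrite vij => /(_ isT).
  by rewrite ltNge ge0.
pose i0 := Ordinal (vertices_nonempty T).
exists (expR (v i0)); first exact: expR_gt0.
split=> [i|[i /v0 vi]]; last by rewrite (vC i0 i) [v i]vi expR0.
rewrite (vC i0 i) /v expRD expRN !lnK ?posrE//.
by rewrite -mulrA mulVf ?mulr1// gt_eqF.
Qed.

(** Every vertex lies in a face, whose total would be negative if [v] did not vanish there. *)
Lemma hyp_rigidity alpha (Rbar : 'I_N -> R) r r' :
  (forall i, alpha * Rbar i <= 0) ->
  packing_metric Hyperbolic T I r -> packing_metric Hyperbolic T I r' ->
  (forall i, alpha_curvature Hyperbolic T alpha I r i = Rbar i) ->
  (forall i, alpha_curvature Hyperbolic T alpha I r' i = Rbar i) ->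
  forall i, r i = r' i.
Proof.
move=> aR pr pr' hr hr' i; have [r_gt0 _] := pr; have [r'_gt0 _] := pr'.
have [ge0 _] := face_totals_ge0 r_gt0 r'_gt0 hr hr' aR
  (fun i j k h => (hyp_face_total pr pr' h).1).
have [j [k h]] := vertex_face T i.
have v0 : ln (tanh (r' i / 2)) - ln (tanh (r i / 2)) = 0.
  apply/eqP; apply/negP => /negP vi.
  have := (hyp_face_total pr pr' h).2 vi.
  by rewrite ltNge ge0.
have tanh_gt0 s : 0 < s -> 0 < tanh (s / 2) by move=> /tanh_half_itv/andP[].
(* [cosh r] is a function of [tanh (r / 2)], so equality of the latter already determines
   [r > 0]. *)
apply: cosh_inj => //; rewrite -!hcos_tanh; congr hcos.
by apply: ln_inj; rewrite ?posrE ?tanh_gt0//; apply/eqP; rewrite eq_sym -subr_eq0 v0.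
Qed.

End rigidity.

Theorem theorem1p2 (R : realType) (alpha : R) (N : nat)
    (T : triangulated_surface N) (I : {set 'I_N} -> R) (Rbar : 'I_N -> R)
    (I_ge0 : nonneg_weight T I)
    (alpha_chi : alpha * (euler_number T)%:~R <= 0) :
  [/\ (forall i, alpha * Rbar i = 0) ->
      forall r r' : 'I_N -> R,
        packing_metric Euclidean T I r ->
        packing_metric Euclidean T I r' ->
        (forall i, alpha_curvature Euclidean T alpha I r i = Rbar i) ->
        (forall i, alpha_curvature Euclidean T alpha I r' i = Rbar i) ->
        exists2 c : R, 0 < c & forall i, r' i = c * r i,
      (forall i, alpha * Rbar i <= 0) ->
      (exists i, alpha * Rbar i <> 0) ->
      forall r r' : 'I_N -> R,
        packing_metric Euclidean T I r ->
        packing_metric Euclidean T I r' ->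
        (forall i, alpha_curvature Euclidean T alpha I r i = Rbar i) ->
        (forall i, alpha_curvature Euclidean T alpha I r' i = Rbar i) ->
        forall i, r i = r' i
    & (forall i, alpha * Rbar i <= 0) ->
      forall r r' : 'I_N -> R,
        packing_metric Hyperbolic T I r ->
        packing_metric Hyperbolic T I r' ->
        (forall i, alpha_curvature Hyperbolic T alpha I r i = Rbar i) ->
        (forall i, alpha_curvature Hyperbolic T alpha I r' i = Rbar i) ->
        forall i, r i = r' i].
Proof.
split=> [aR|aR aR_neq0|aR] r r' pr pr' hr hr'.
- have aR' i : alpha * Rbar i <= 0 by rewrite aR.
  have [c c_gt0 [rE _]] := euc_rigidity I_ge0 aR' pr pr' hr hr'.
  by exists c.
- move=> i; have [c _ [-> c1]] := euc_rigidity I_ge0 aR pr pr' hr hr'.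
  by rewrite c1 ?mul1r.
- exact: (hyp_rigidity I_ge0 aR pr pr' hr hr').
Qed.
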